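(* For each of the following ten triples $(Q',Q'',c)$, and every positive integer $n$ for which both formulae are defined, the quadrature formulae $Q'$ and $Q''$ are negative definite of order $4$, the quadrature formula $\widehat{Q}=(c+1)Q'-c\,Q''$ is positive definite of order $4$, and $c$ is the smallest positive number with this latter property: 1. $Q'=Q_{(3.2.1),2n}$, $Q''=Q_{(3.1.1),n}$, $c=\frac{104}{299}$; 2. $Q'=Q_{(3.2.1),2n}$, $Q''=Q_{(3.1.3),n}$, $c=\frac{52}{77}$; 3. $Q'=Q_{(3.2.1),2n}$, $Q''=Q_{(3.2.1),n}$, $c=1$; 4. $Q'=Q_{(3.2.1),2n}$, $Q''=Q_{(3.2.2),n}$, $c=\frac{13}{29}$; 5. $Q'=Q_{(3.2.1),2n}$, $Q''=Q_{(3.2.3),n}$, $c=\frac13$; 6. $Q'=Q_{(3.2.2),2n}$, $Q''=Q_{(3.1.1),n}$, $c=\frac{168}{235}$; 7. $Q'=Q_{(3.2.2),2n}$, $Q''=Q_{(3.1.3),n}$, $c=\frac{28}{15}$; 8. $Q'=Q_{(3.2.2),2n}$, $Q''=Q_{(3.2.2),n}$, $c=1$; 9. $Q'=Q_{(3.2.2),2n}$, $Q''=Q_{(3.2.3),n}$, $c=\frac13$; 10. $Q'=Q_{(3.2.3),2n}$, $Q''=Q_{(3.2.3),n}$, $c=1$.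
   Context: A quadrature formula is a functional $Q[f]=\sum_{i=1}^{N}a_i f(\tau_i)$ with finitely many nodes $0\le\tau_1<\dots<\tau_N\le 1$ and real weights; its remainder is $R[Q;f]=\int_0^1 f(x)\,dx-Q[f]$. $Q$ is positive (respectively negative) definite of order $4$ if there is a constant $c_4(Q)>0$ (respectively $c_4(Q)<0$) such that for every $f\in C^4[0,1]$ there is $\xi\in[0,1]$ with $R[Q;f]=c_4(Q)f^{(4)}(\xi)$. Write $\sigma(x):=f(x)+f(1-x)$ and $y_{k,n}:=\frac{2k-1}{2n}$. The formulae are as follows (empty sums are $0$). $Q_{(3.1.1),n}[f]=\frac{403}{1152n}\sigma(0)+\frac{159}{128n}\sigma(\frac1n)+\frac{113}{128n}\sigma(\frac2n)+\frac{1181}{1152n}\sigma(\frac3n)+\frac1n\sum_{k=4}^{n-4}f(\frac kn)$, defined for $n\ge7$. $Q_{(3.1.3),n}[f]=\frac{43}{192n}\sigma(0)+\frac{29}{72n}\sigma(\frac1{2n})+\frac{83}{96n}\sigma(\frac1n)+\frac{581}{576n}\sigma(\frac2n)+\frac1n\sum_{k=3}^{n-3}f(\frac kn)$, defined for $n\ge5$. $Q_{(3.2.1),n}[f]=\frac{13}{72n}\sigma(0)+\frac1{2n}\sigma(\frac1{2n})+\frac4{9n}\sigma(\frac3{4n})-\frac1{8n}\sigma(\frac1n)+\frac1n\sum_{k=2}^{n-1}f(y_{k,n})$, defined for $n\ge3$. $Q_{(3.2.2),n}[f]=\frac{7}{24n}\sigma(0)-\frac4{9n}\sigma(\frac1{4n})+\frac7{6n}\sigma(\frac1{2n})-\frac1{72n}\sigma(\frac1n)+\frac1n\sum_{k=2}^{n-1}f(y_{k,n})$,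 defined for $n\ge3$. $Q_{(3.2.3),n}[f]=\frac{11}{12n}\sigma(0)-\frac3{2n}\sigma(\frac1{12n})+\frac3{4n}\sigma(\frac1{6n})-\frac1{6n}\sigma(\frac1{4n})+\frac1n\sum_{k=1}^{n}f(y_{k,n})$, defined for $n\ge1$. $Q_{(\cdot),2n}$ denotes the corresponding formula with $n$ replaced by $2n$. *)

(* Defs.v *)
From Stdlib Require Import Reals List.
From Coquelicot Require Import Coquelicot.
Open Scope R_scope.

Definition unit_interval (x : R) : Prop := 0 <= x <= 1.

(* [f] is in C^4[0,1] and [f4] is its fourth derivative there. Differentiability
   and continuity are relative to [0,1], hence one-sided at the endpoints; the
   values of [f] and of its derivatives outside [0,1] play no role. *)
Definition C4_with_fourth_derivative (f f4 : R -> R) : Prop :=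
  exists f1 f2 f3 : R -> R,
    forall x : R, unit_interval x ->
      D_in f f1 unit_interval x /\
      D_in f1 f2 unit_interval x /\
      D_in f2 f3 unit_interval x /\
      D_in f3 f4 unit_interval x /\
      continue_in f4 unit_interval x.

Definition functional : Type := (R -> R) -> R.

Definition is_quadrature (Q : functional) : Prop :=
  exists (N : nat) (a tau : nat -> R),
    (forall i : nat, (1 <= i <= N)%nat -> 0 <= tau i <= 1) /\
    (forall i j : nat, (1 <= i)%nat -> (i < j)%nat -> (j <= N)%nat ->
       tau i < tau j) /\
    (forall f : R -> R, Q f = sum_n_m (fun i => a i * f (tau i)) 1 N).

Definition remainder (Q : functional) (f : R -> R) : R := RInt f 0 1 - Q f.

Definition definite4_with_constant (Q : functional) (c4 : R) : Prop :=
  forall f f4 : R -> R, C4_with_fourth_derivative f f4 ->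
    exists xi : R, unit_interval xi /\ remainder Q f = c4 * f4 xi.

Definition positive_definite4 (Q : functional) : Prop :=
  is_quadrature Q /\ exists c4 : R, c4 > 0 /\ definite4_with_constant Q c4.

Definition negative_definite4 (Q : functional) : Prop :=
  is_quadrature Q /\ exists c4 : R, c4 < 0 /\ definite4_with_constant Q c4.

Definition sigma (f : R -> R) (x : R) : R := f x + f (1 - x).

Definition y (k n : nat) : R := (2 * INR k - 1) / (2 * INR n).

(* A sequence of formulae indexed by [n], meaningful only for [n >= first_index].
   In the formulae below [sum_n_m u p q] is 0 when [q < p], and no natural-number
   subtraction truncates from [first_index] on. *)
Record formula_sequence : Type := {
  first_index : nat;
  formula : nat -> functional
}.

Definition Q_3_1_1 : formula_sequence := {|
  first_index := 7;
  formula := fun n f =>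
    403 / (1152 * INR n) * sigma f 0
    + 159 / (128 * INR n) * sigma f (1 / INR n)
    + 113 / (128 * INR n) * sigma f (2 / INR n)
    + 1181 / (1152 * INR n) * sigma f (3 / INR n)
    + 1 / INR n * sum_n_m (fun k => f (INR k / INR n)) 4 (n - 4)
|}.

Definition Q_3_1_3 : formula_sequence := {|
  first_index := 5;
  formula := fun n f =>
    43 / (192 * INR n) * sigma f 0
    + 29 / (72 * INR n) * sigma f (1 / (2 * INR n))
    + 83 / (96 * INR n) * sigma f (1 / INR n)
    + 581 / (576 * INR n) * sigma f (2 / INR n)
    + 1 / INR n * sum_n_m (fun k => f (INR k / INR n)) 3 (n - 3)
|}.

Definition Q_3_2_1 : formula_sequence := {|
  first_index := 3;
  formula := fun n f =>
    13 / (72 * INR n) * sigma f 0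
    + 1 / (2 * INR n) * sigma f (1 / (2 * INR n))
    + 4 / (9 * INR n) * sigma f (3 / (4 * INR n))
    - 1 / (8 * INR n) * sigma f (1 / INR n)
    + 1 / INR n * sum_n_m (fun k => f (y k n)) 2 (n - 1)
|}.

Definition Q_3_2_2 : formula_sequence := {|
  first_index := 3;
  formula := fun n f =>
    7 / (24 * INR n) * sigma f 0
    - 4 / (9 * INR n) * sigma f (1 / (4 * INR n))
    + 7 / (6 * INR n) * sigma f (1 / (2 * INR n))
    - 1 / (72 * INR n) * sigma f (1 / INR n)
    + 1 / INR n * sum_n_m (fun k => f (y k n)) 2 (n - 1)
|}.

Definition Q_3_2_3 : formula_sequence := {|
  first_index := 1;
  formula := fun n f =>
    11 / (12 * INR n) * sigma f 0
    - 3 / (2 * INR n) * sigma f (1 / (12 * INR n))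
    + 3 / (4 * INR n) * sigma f (1 / (6 * INR n))
    - 1 / (6 * INR n) * sigma f (1 / (4 * INR n))
    + 1 / INR n * sum_n_m (fun k => f (y k n)) 1 n
|}.

Definition Q_hat (c : R) (Q' Q'' : functional) : functional :=
  fun f => (c + 1) * Q' f - c * Q'' f.

Definition smallest_positive (P : R -> Prop) (c : R) : Prop :=
  0 < c /\ P c /\ forall c' : R, 0 < c' -> P c' -> c <= c'.

(* Main.v *)
Require Import Defs.
From Stdlib Require Import Reals List Lra Lia Sorted.
From Coquelicot Require Import Coquelicot.
Import ListNotations.
Open Scope R_scope.

(** A rule [Q] with finitely many nodes in [0,1] that is exact on cubics has the
    Peano representation: its remainder at [f] is the integral over [0,1] of the
    kernel [K] times the fourth derivative, where [K t] is
    [t ^ 4 / 24 - Q ((t - .)_+ ^ 3 / 6)].  Hence, [K] being continuous, [Q] is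
    positive (negative) definite of order four as soon as [K >= 0] ([K <= 0])
    and [K] is not identically zero, by the mean value theorem
    ([positive_definite4_of_kernel], [negative_definite4_of_kernel]).
    Conversely, if [Q] is positive definite then [K >= 0]: otherwise an [f]
    whose fourth derivative is the negative part of [K] has a negative
    remainder ([kernel_nonneg_of_positive_definite4]).

    All the rules are invariant under [x -> 1 - x], so only [0 <= x <= 1/2]
    matters. There [24 n ^ 4 K x] is a function [kappa] of [s = n x] alone: the
    sum of the truncated cubes at the equidistant nodes telescopes to values of
    [u ^ 2 (1 - u) ^ 2] and of its periodic extension ([beta_step]). Beyond a
    boundary layer of length at most [3], [kappa] is the 1-periodic function
    equal to [- d ^ 2 (1/2 - d ^ 2)], with [d] the distance to the nearest
    midpoint between two equidistant nodes; inside the layer it is an explicit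
    spline of degree four.

    For the extrapolated rule the kernel is a positive multiple of
    [(c + 1) kappa' (2 s) - 16 c kappa'' s]. In the interior this is nonnegative
    for [c >= 1/3], because [kappa' (2 s)] is there at least [4 kappa'' s]. In
    the layer it is a spline with finitely many pieces, each with nonnegative
    Bernstein coefficients on its interval. The constant [c] is smallest for one of
    two reasons. As [s] tends to [0] the expression behaves like
    [- 32 ((c + 1) a' - 2 c a'') s ^ 3], with [a'] and [a''] the end point
    weights, so that [c >= a' / (2 a'' - a')]
    ([hat_kernel_end_weight]); this gives all the constants except in the two
    pairs that combine [Q_3_2_1] or [Q_3_2_2] with [Q_3_2_3]. In these, both
    kernels vanish quadratically at [s = 1], where their ratio tends to [1/4];
    this forces
    [c >= 1/3] ([hat_kernel_interior_zero]). *)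

(** * Finite linear combinations of point evaluations *)

(** The combination with weight [fst p] at the node [snd p] for each [p] in [l];
    nodes may repeat and come in any order. *)
Fixpoint weighted_sum (l : list (R * R)) (f : R -> R) : R :=
  match l with
  | [] => 0
  | p :: l' => fst p * f (snd p) + weighted_sum l' f
  end.

(** Combinations of evaluations at points of [0,1]. Unlike [is_quadrature], this
    is visibly closed under linear combinations. *)
Definition nodal (Q : functional) : Prop :=
  exists l : list (R * R),
    (forall p, In p l -> unit_interval (snd p)) /\
    forall f, Q f = weighted_sum l f.

Lemma weighted_sum_app (l1 l2 : list (R * R)) (f : R -> R) :
  weighted_sum (l1 ++ l2) f = weighted_sum l1 f + weighted_sum l2 f.
Proof. induction l1 as [|p l1 IH]; simpl; [ring | rewrite IH; ring]. Qed.

Lemma nodal_eval (x : R) : unit_interval x -> nodal (fun f => f x).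
Proof.
  intros Hx; exists [(1, x)]; split.
  - intros p [<- | []]; exact Hx.
  - intros f; simpl; ring.
Qed.

Lemma nodal_plus (Q1 Q2 : functional) :
  nodal Q1 -> nodal Q2 -> nodal (fun f => Q1 f + Q2 f).
Proof.
  intros [l1 [H1 E1]] [l2 [H2 E2]]; exists (l1 ++ l2); split.
  - intros p Hp; apply in_app_or in Hp; destruct Hp; auto.
  - intros f; rewrite weighted_sum_app, E1, E2; reflexivity.
Qed.

Lemma nodal_scal (c : R) (Q : functional) : nodal Q -> nodal (fun f => c * Q f).
Proof.
  intros [l [H E]]; exists (map (fun p => (c * fst p, snd p)) l); split.
  - intros p Hp; apply in_map_iff in Hp; destruct Hp as [q [<- Hq]]; exact (H q Hq).
  - intros f; rewrite E; clear H E; induction l as [|q l IH]; simpl; [ring|].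
    rewrite <- IH; ring.
Qed.

Lemma nodal_minus (Q1 Q2 : functional) :
  nodal Q1 -> nodal Q2 -> nodal (fun f => Q1 f - Q2 f).
Proof.
  intros H1 H2.
  destruct (nodal_plus _ _ H1 (nodal_scal (-1) _ H2)) as [l [H E]].
  exists l; split; [exact H|]; intros f; rewrite <- E; ring.
Qed.

Lemma nodal_zero : nodal (fun _ => 0).
Proof. exists []; split; [intros p [] | reflexivity]. Qed.

Lemma nodal_sigma (x : R) : unit_interval x -> nodal (fun f => Defs.sigma f x).
Proof.
  intros Hx; apply (nodal_plus (fun f => f x) (fun f => f (1 - x)));
    apply nodal_eval; unfold unit_interval in *; lra.
Qed.

Lemma nodal_sum (node : nat -> R) (p q : nat) :
  (forall k, (p <= k <= q)%nat -> unit_interval (node k)) ->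
  nodal (fun f => sum_n_m (fun k => f (node k)) p q).
Proof.
  intros H; induction q as [|q IH].
  - destruct p as [|p].
    + destruct (nodal_eval (node 0%nat)) as [l [Hl E]]; [apply H; lia|].
      exists l; split; [exact Hl|]; intros f; rewrite sum_n_n; apply E.
    + destruct nodal_zero as [l [Hl E]]; exists l; split; [exact Hl|].
      intros f; rewrite sum_n_m_zero by lia; apply E.
  - destruct (Nat.le_gt_cases p (S q)) as [Hp | Hp].
    + destruct (nodal_plus _ _ (IH ltac:(intros; apply H; lia))
                  (nodal_eval (node (S q)) (H (S q) ltac:(lia)))) as [l [Hl E]].
      exists l; split; [exact Hl|]; intros f; rewrite sum_n_Sm by lia; apply E.
    + destruct nodal_zero as [l [Hl E]]; exists l; split; [exact Hl|].
      intros f; rewrite sum_n_m_zero by lia; apply E.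
Qed.

Lemma nodal_Q_hat (c : R) (Q1 Q2 : functional) :
  nodal Q1 -> nodal Q2 -> nodal (Q_hat c Q1 Q2).
Proof.
  intros H1 H2.
  exact (nodal_minus _ _ (nodal_scal (c + 1) _ H1) (nodal_scal c _ H2)).
Qed.

Definition node_lt (p q : R * R) : Prop := snd p < snd q.

(** Sorted insertion of one weighted node; weights at equal nodes are added. *)
Lemma insert_node (p : R * R) (l : list (R * R)) :
  StronglySorted node_lt l ->
  exists l', StronglySorted node_lt l' /\
    (forall q, In q l' -> snd q = snd p \/ exists r, In r l /\ snd q = snd r) /\
    forall f, weighted_sum l' f = fst p * f (snd p) + weighted_sum l f.
Proof.
  induction l as [|r l IH]; intros Hs.
  - exists [p]; repeat split.
    + constructor; constructor.
    + intros q [<- | []]; left; reflexivity.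
  - inversion Hs as [|r' l0 Hs' Hr]; subst.
    destruct (Rtotal_order (snd p) (snd r)) as [Hlt | [Heq | Hgt]].
    + exists (p :: r :: l); repeat split.
      * constructor; [exact Hs|]; constructor; [exact Hlt|].
        eapply Forall_impl; [|exact Hr]; unfold node_lt; intros; lra.
      * intros q [<- | Hq]; [left; reflexivity | right; exists q; auto].
    + exists ((fst p + fst r, snd r) :: l); repeat split.
      * constructor; [exact Hs' | exact Hr].
      * intros q [<- | Hq]; [left; simpl; auto | right; exists q; simpl; auto].
      * intros f; simpl; rewrite Heq; ring.
    + destruct (IH Hs') as [l' [Hs2 [Hin E]]].
      exists (r :: l'); repeat split.
      * constructor; [exact Hs2|]; apply Forall_forall; intros q Hq.
        destruct (Hin q Hq) as [E1 | [t [Ht E1]]]; unfold node_lt; rewrite E1.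
        -- exact Hgt.
        -- rewrite Forall_forall in Hr; exact (Hr t Ht).
      * intros q [<- | Hq]; [right; exists r; simpl; auto|].
        destruct (Hin q Hq) as [E1 | [t [Ht E1]]]; [left; exact E1|].
        right; exists t; simpl; auto.
      * intros f; simpl; rewrite E; ring.
Qed.

Lemma sort_nodes (l : list (R * R)) :
  (forall p, In p l -> unit_interval (snd p)) ->
  exists l', StronglySorted node_lt l' /\
    (forall p, In p l' -> unit_interval (snd p)) /\
    forall f, weighted_sum l' f = weighted_sum l f.
Proof.
  induction l as [|p l IH]; intros H.
  - exists []; split; [constructor | split; [intros p [] | reflexivity]].
  - destruct IH as [l1 [S1 [U1 E1]]]; [intros; apply H; simpl; auto|].
    destruct (insert_node p l1 S1) as [l2 [S2 [U2 E2]]].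
    exists l2; split; [exact S2|]; split.
    + intros q Hq; destruct (U2 q Hq) as [-> | [r [Hr ->]]];
        [apply H; simpl; auto | auto].
    + intros f; rewrite E2, E1; reflexivity.
Qed.

Lemma StronglySorted_nth (l : list (R * R)) (d : R * R) :
  StronglySorted node_lt l ->
  forall i j, (i < j)%nat -> (j < length l)%nat -> node_lt (nth i l d) (nth j l d).
Proof.
  induction 1 as [|p l Hs IH Hp]; intros i j Hij Hj; simpl in Hj; [lia|].
  destruct j as [|j]; [lia|]; destruct i as [|i]; simpl.
  - rewrite Forall_forall in Hp; apply Hp, nth_In; lia.
  - apply IH; lia.
Qed.

Lemma weighted_sum_nth (l : list (R * R)) (d : R * R) (f : R -> R) :
  weighted_sum l f =
  sum_n_m (fun i => fst (nth (i - 1) l d) * f (snd (nth (i - 1) l d))) 1 (length l).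
Proof.
  induction l as [|p l IH]; simpl length.
  - rewrite sum_n_m_zero by lia; reflexivity.
  - rewrite sum_Sn_m, <- sum_n_m_S by lia; simpl weighted_sum; rewrite IH.
    apply (f_equal (Rplus (fst p * f (snd p)))), sum_n_m_ext_loc.
    intros [|k] Hk; [lia|]; simpl.
    rewrite Nat.sub_0_r; reflexivity.
Qed.

Lemma nodal_is_quadrature (Q : functional) : nodal Q -> is_quadrature Q.
Proof.
  intros [l0 [H0 E0]]; destruct (sort_nodes l0 H0) as [l [Hs [Hu E]]].
  exists (length l), (fun i => fst (nth (i - 1) l (0, 0))),
    (fun i => snd (nth (i - 1) l (0, 0))); repeat split.
  - apply Hu, nth_In; lia.
  - apply Hu, nth_In; lia.
  - intros i j Hi Hij Hj; apply StronglySorted_nth; [exact Hs | lia | lia].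
  - intros f; rewrite E0, <- E; apply weighted_sum_nth.
Qed.

Lemma nodal_ext (Q : functional) (f g : R -> R) :
  nodal Q -> (forall x, unit_interval x -> f x = g x) -> Q f = Q g.
Proof.
  intros [l [H E]] Hfg; rewrite !E; clear E; induction l as [|p l IH]; simpl;
    [reflexivity|].
  rewrite IH by (intros; apply H; simpl; auto).
  rewrite Hfg by (apply H; simpl; auto); reflexivity.
Qed.

Lemma nodal_additive (Q : functional) (f g : R -> R) :
  nodal Q -> Q (fun x => f x + g x) = Q f + Q g.
Proof.
  intros [l [H E]]; rewrite !E; clear H E; induction l as [|p l IH]; simpl;
    [ring | rewrite IH; ring].
Qed.

(** * The Peano kernel *)

(** The positive part [u_+]. *)
Definition pos_part (u : R) : R := Rmax 0 u.

Lemma pos_part_of_nonneg (u : R) : 0 <= u -> pos_part u = u.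
Proof. intros; unfold pos_part; rewrite Rmax_right; auto. Qed.

Lemma pos_part_of_nonpos (u : R) : u <= 0 -> pos_part u = 0.
Proof. intros; unfold pos_part; rewrite Rmax_left; auto. Qed.

Lemma pos_part_nonneg (u : R) : 0 <= pos_part u.
Proof. apply Rmax_l. Qed.

Lemma pos_part_minus_pos_opp_cubed (u : R) : pos_part u ^ 3 - pos_part (- u) ^ 3 = u ^ 3.
Proof.
  destruct (Rle_dec 0 u).
  - rewrite (pos_part_of_nonneg u), (pos_part_of_nonpos (- u)) by lra; ring.
  - rewrite (pos_part_of_nonpos u), (pos_part_of_nonneg (- u)) by lra; ring.
Qed.

Lemma continuous_of_lipschitz (f : R -> R) :
  (forall x x', Rabs (f x' - f x) <= Rabs (x' - x)) -> forall x, continuous f x.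
Proof.
  intros H x; apply continuity_pt_filterlim; intros eps Heps.
  exists eps; split; [exact Heps|]; intros x' [_ Hx']; simpl in *; unfold R_dist in *.
  eapply Rle_lt_trans; [apply H | exact Hx'].
Qed.

Lemma continuous_pos_part (u : R) : continuous pos_part u.
Proof.
  apply continuous_of_lipschitz; intros x x'; unfold pos_part, Rmax.
  repeat destruct Rle_dec; unfold Rabs; repeat destruct Rcase_abs; lra.
Qed.

(** The projection of the line onto [0,1]. *)
Definition clamp (x : R) : R := Rmax 0 (Rmin 1 x).

Lemma clamp_in (x : R) : unit_interval (clamp x).
Proof.
  unfold clamp, unit_interval, Rmax, Rmin; repeat destruct Rle_dec; lra.
Qed.

Lemma clamp_id (x : R) : unit_interval x -> clamp x = x.
Proof.
  unfold clamp, unit_interval, Rmax, Rmin; repeat destruct Rle_dec; lra.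
Qed.

Lemma clamp_lipschitz (x x' : R) : Rabs (clamp x' - clamp x) <= Rabs (x' - x).
Proof.
  unfold clamp, Rmax, Rmin.
  repeat destruct Rle_dec; unfold Rabs; repeat destruct Rcase_abs; lra.
Qed.

Lemma continuous_clamp (f : R -> R) :
  (forall x, unit_interval x -> continue_in f unit_interval x) ->
  forall x, continuous (fun z => f (clamp z)) x.
Proof.
  intros H x; apply continuity_pt_filterlim; intros eps Heps.
  destruct (H (clamp x) (clamp_in x) eps Heps) as [d [Hd Hlim]].
  exists d; split; [exact Hd|]; intros x' [_ Hx']; simpl in *; unfold R_dist in *.
  destruct (Req_dec (clamp x') (clamp x)) as [-> | Hne].
  - rewrite Rminus_diag, Rabs_R0; exact Heps.
  - apply Hlim; split.
    + split; [apply clamp_in | auto].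
    + eapply Rle_lt_trans; [apply clamp_lipschitz | exact Hx'].
Qed.

(** Inside (0,1) the derivative relative to [0,1] is the ordinary one. *)
Lemma is_derive_clamp (f f' : R -> R) (x : R) :
  D_in f f' unit_interval x -> 0 < x < 1 ->
  is_derive (fun z => f (clamp z)) x (f' (clamp x)).
Proof.
  intros H Hx.
  apply is_derive_ext_loc with f.
  - assert (He : 0 < Rmin x (1 - x)) by (apply Rmin_pos; lra).
    exists (mkposreal _ He); intros z Hz.
    unfold ball in Hz; simpl in Hz; unfold AbsRing_ball, abs, minus, plus, opp in Hz;
      simpl in Hz.
    pose proof (Rmin_l x (1 - x)); pose proof (Rmin_r x (1 - x)).
    rewrite clamp_id; [reflexivity|].
    unfold unit_interval; revert Hz; unfold Rabs; destruct Rcase_abs; lra.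
  - rewrite clamp_id by (unfold unit_interval; lra).
    apply is_derive_Reals; intros eps Heps.
    destruct (H eps Heps) as [d [Hd Hlim]].
    assert (He : 0 < Rmin d (Rmin x (1 - x))) by (repeat apply Rmin_pos; lra).
    exists (mkposreal _ He); intros h Hh0 Hh; simpl in Hh.
    pose proof (Rmin_l d (Rmin x (1 - x))); pose proof (Rmin_r d (Rmin x (1 - x))).
    pose proof (Rmin_l x (1 - x)); pose proof (Rmin_r x (1 - x)).
    specialize (Hlim (x + h)); simpl in Hlim; unfold R_dist in Hlim.
    replace (x + h - x) with h in Hlim by ring.
    apply Hlim; split; [|lra]; split; [|lra].
    unfold unit_interval; revert Hh; unfold Rabs; destruct Rcase_abs; lra.
Qed.

Lemma is_RInt_of_continuous (g : R -> R) (a b : R) :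
  (forall x, continuous g x) -> is_RInt g a b (RInt g a b).
Proof.
  intros Hg; apply (RInt_correct (V := R_CompleteNormedModule)).
  apply (ex_RInt_continuous (V := R_CompleteNormedModule)); auto.
Qed.

(** The fundamental theorem with a derivative only in the open interval. *)
Lemma is_RInt_open_derive (F g : R -> R) (a b : R) :
  a <= b ->
  (forall x, continuous F x) -> (forall x, continuous g x) ->
  (forall x, a < x < b -> is_derive F x (g x)) ->
  is_RInt g a b (F b - F a).
Proof.
  intros Hab HF Hg HD.
  assert (HP : forall x, is_derive (fun z => RInt g a z) x (g x)).
  { intros x; apply is_derive_RInt with a; [|apply Hg].
    apply filter_forall; intros z; apply is_RInt_of_continuous, Hg. }
  destruct (MVT_gen (fun x => F x - RInt g a x) a b (fun _ => 0)) as [c [_ Hc]].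
  - intros x Hx; rewrite Rmin_left, Rmax_right in Hx by lra.
    replace 0 with (minus (g x) (g x))
      by (unfold minus, plus, opp; simpl; ring).
    apply (is_derive_minus F (fun z => RInt g a z)); [apply HD, Hx | apply HP].
  - intros x _; apply continuity_pt_filterlim.
    apply (continuous_minus F (fun z => RInt g a z)); [apply HF|].
    apply ex_derive_continuous; eexists; apply HP.
  - rewrite (RInt_point a g) in Hc; unfold zero in Hc; simpl in Hc.
    replace (F b - F a) with (RInt g a b) by lra.
    apply is_RInt_of_continuous, Hg.
Qed.

(** A function in C^4[0,1] and its derivatives, extended by constants outside
    [0,1], are continuous on the line; the two-sided derivatives are then only
    needed inside (0,1). *)
Lemma C4_clamped (f f4 : R -> R) :
  C4_with_fourth_derivative f f4 ->
  exists g g1 g2 g3 g4 : R -> R,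
    (forall x, continuous g x) /\ (forall x, continuous g1 x) /\
    (forall x, continuous g2 x) /\ (forall x, continuous g3 x) /\
    (forall x, continuous g4 x) /\
    (forall x, 0 < x < 1 -> is_derive g x (g1 x) /\ is_derive g1 x (g2 x) /\
                            is_derive g2 x (g3 x) /\ is_derive g3 x (g4 x)) /\
    (forall x, unit_interval x -> g x = f x) /\
    (forall x, g4 x = f4 (clamp x)).
Proof.
  intros [f1 [f2 [f3 H]]].
  exists (fun z => f (clamp z)), (fun z => f1 (clamp z)), (fun z => f2 (clamp z)),
    (fun z => f3 (clamp z)), (fun z => f4 (clamp z)).
  repeat match goal with |- _ /\ _ => split end;
    try (apply continuous_clamp; intros z Hz; destruct (H z Hz) as [D0 [D1 [D2 [D3 C]]]];
         first [exact C | eapply cont_deriv; eassumption]).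
  - intros z Hz.
    destruct (H z) as [D0 [D1 [D2 [D3 _]]]]; [unfold unit_interval; lra|].
    repeat match goal with |- _ /\ _ => split end; apply is_derive_clamp; assumption.
  - intros x Hx; rewrite clamp_id; auto.
  - reflexivity.
Qed.

Definition exact_on_cubics (Q : functional) : Prop :=
  forall c0 c1 c2 c3 : R,
    Q (fun x => c0 + c1 * x + c2 * x ^ 2 + c3 * x ^ 3) = c0 + c1 / 2 + c2 / 3 + c3 / 4.

(** The kernel [K] with [remainder Q f = RInt (K * f4) 0 1]: the remainder of
    the truncated power [(t - .)_+^3 / 6], whose integral over [0,1] is
    [t ^ 4 / 24]. *)
Definition peano_kernel (Q : functional) (t : R) : R :=
  t ^ 4 / 24 - Q (fun u => pos_part (t - u) ^ 3 / 6).

Lemma is_RInt_ext_open (f g : R -> R) (a b l : R) :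
  a <= b -> (forall x, a < x < b -> f x = g x) -> is_RInt f a b l -> is_RInt g a b l.
Proof.
  intros Hab Hfg; apply is_RInt_ext; intros x Hx; apply Hfg.
  rewrite Rmin_left, Rmax_right in Hx; lra.
Qed.

Lemma is_RInt_zero (a b : R) : is_RInt (fun _ : R => 0) a b 0.
Proof.
  pose proof (is_RInt_const a b 0) as H; revert H.
  unfold scal; simpl; unfold mult; simpl; rewrite Rmult_0_r; auto.
Qed.

Lemma is_RInt_weighted_sum (l : list (R * R)) (h : R -> R -> R) (v : R -> R) :
  (forall p, In p l -> unit_interval (snd p)) ->
  (forall u, unit_interval u -> is_RInt (h u) 0 1 (v u)) ->
  is_RInt (fun t => weighted_sum l (fun u => h u t)) 0 1 (weighted_sum l v).
Proof.
  intros Hl Hh; induction l as [|p l IH]; simpl.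
  - apply is_RInt_zero.
  - apply (is_RInt_plus (fun t => fst p * h (snd p) t)
             (fun t => weighted_sum l (fun u => h u t))).
    + apply (is_RInt_scal (h (snd p)) 0 1 (fst p)), Hh, Hl; simpl; auto.
    + apply IH; intros; apply Hl; simpl; auto.
Qed.

Lemma continuous_weighted_sum (l : list (R * R)) (h : R -> R -> R) (t : R) :
  (forall u, continuous (h u) t) ->
  continuous (fun t => weighted_sum l (fun u => h u t)) t.
Proof.
  intros Hh; induction l as [|p l IH]; simpl.
  - apply continuous_const.
  - apply (continuous_plus (fun t => fst p * h (snd p) t)
             (fun t => weighted_sum l (fun u => h u t)) t).
    + apply (continuous_scal_r (fst p) (h (snd p)) t), Hh.
    + exact IH.
Qed.

Lemma continuous_mult_R (f g : R -> R) (x : R) :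
  continuous f x -> continuous g x -> continuous (fun z => f z * g z) x.
Proof. exact (continuous_mult f g x). Qed.

Lemma continuous_pow (n : nat) (f : R -> R) (x : R) :
  continuous f x -> continuous (fun z => f z ^ n) x.
Proof.
  intros Hf; induction n as [|n IH]; simpl.
  - apply continuous_const.
  - apply continuous_mult_R; assumption.
Qed.

Lemma continuous_minus_const (c x : R) : continuous (fun t => t - c) x.
Proof.
  apply (continuous_minus (fun t => t) (fun _ => c));
    [apply continuous_id | apply continuous_const].
Qed.

Lemma continuous_truncated_power (u t : R) :
  continuous (fun t => pos_part (t - u) ^ 3 / 6) t.
Proof.
  unfold Rdiv; apply continuous_mult_R; [|apply continuous_const].
  apply (continuous_pow 3 (fun t => pos_part (t - u))).
  apply (continuous_comp (fun t => t - u) pos_part); [apply continuous_minus_const|].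
  apply continuous_pos_part.
Qed.

Lemma continuous_peano_kernel (Q : functional) (t : R) :
  nodal Q -> continuous (peano_kernel Q) t.
Proof.
  intros [l [_ E]].
  apply (continuous_ext
           (fun t => t ^ 4 / 24 - weighted_sum l (fun u => pos_part (t - u) ^ 3 / 6))).
  { intros x; unfold peano_kernel; rewrite E; reflexivity. }
  apply (continuous_minus (fun t => t ^ 4 / 24)
           (fun t => weighted_sum l (fun u => pos_part (t - u) ^ 3 / 6))).
  - unfold Rdiv; apply continuous_mult_R; [|apply continuous_const].
    apply (continuous_pow 4 (fun t => t)), continuous_id.
  - apply (continuous_weighted_sum l (fun u t => pos_part (t - u) ^ 3 / 6)); intros u.
    apply continuous_truncated_power.
Qed.

(** Continuity of polynomial expressions in functions known to be continuous. *)
Ltac continuity_solve :=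
  lazymatch goal with
  | |- continuous (fun _ => ?c) _ => apply continuous_const
  | |- continuous (fun z => z) _ => apply continuous_id
  | |- continuous (fun z => @?f z + @?g z) ?x =>
      apply (continuous_plus f g x); continuity_solve
  | |- continuous (fun z => @?f z - @?g z) ?x =>
      apply (continuous_minus f g x); continuity_solve
  | |- continuous (fun z => @?f z * @?g z) ?x =>
      apply (continuous_mult_R f g x); continuity_solve
  | |- continuous (fun z => @?f z / ?c) ?x =>
      apply (continuous_mult_R f (fun _ => / c) x); continuity_solve
  | |- continuous (fun z => @?f z ^ ?n) ?x =>
      apply (continuous_pow n f x); continuity_solve
  | H : forall x, continuous ?g x |- continuous (fun z => ?g z) _ => apply H
  | _ => auto
  end.

(** Peano's kernel theorem for order four. *)
Lemma remainder_peano (Q : functional) (f f4 : R -> R) :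
  nodal Q -> exact_on_cubics Q -> C4_with_fourth_derivative f f4 ->
  is_RInt (fun t => peano_kernel Q t * f4 (clamp t)) 0 1 (remainder Q f).
Proof.
  intros HQ Hex HC.
  destruct (C4_clamped f f4 HC) as
    [g [g1 [g2 [g3 [g4 [C0 [C1 [C2 [C3 [C4 [HD [Hg Hg4]]]]]]]]]]]].
  (* The integral of [f], by repeated integration by parts from the left end. *)
  pose (H := fun t => t * g t - t ^ 2 / 2 * g1 t + t ^ 3 / 6 * g2 t - t ^ 4 / 24 * g3 t).
  assert (IH : is_RInt (fun t => g t - t ^ 4 / 24 * g4 t) 0 1 (H 1 - H 0)).
  { apply is_RInt_open_derive; [lra | unfold H; intros; continuity_solve
      | intros; continuity_solve |].
    intros x Hx; destruct (HD x Hx) as [D0 [D1 [D2 D3]]]; unfold H.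
    auto_derive.
    - repeat split; eexists; eassumption.
    - rewrite (is_derive_unique (fun z : R => g z) x _ D0),
        (is_derive_unique (fun z : R => g1 z) x _ D1),
        (is_derive_unique (fun z : R => g2 z) x _ D2),
        (is_derive_unique (fun z : R => g3 z) x _ D3).
      simpl; field. }
  assert (If4 : is_RInt (fun t => t ^ 4 / 24 * g4 t) 0 1
                  (RInt (fun t => t ^ 4 / 24 * g4 t) 0 1))
    by (apply is_RInt_of_continuous; intros; continuity_solve).
  set (V := RInt (fun t => t ^ 4 / 24 * g4 t) 0 1) in If4.
  assert (Ig : RInt f 0 1 = H 1 - H 0 + V).
  { apply is_RInt_unique.
    apply is_RInt_ext_open with (fun t => (g t - t ^ 4 / 24 * g4 t) + t ^ 4 / 24 * g4 t);
      [lra | |].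
    - intros x Hx; rewrite <- Hg by (unfold unit_interval; lra); ring.
    - apply (is_RInt_plus (fun t => g t - t ^ 4 / 24 * g4 t)); assumption. }
  (* [T] is the Taylor polynomial of [f] at [1]; expanding at the right end puts
     the node in the truncated power as [t - u], with the sign wanted. *)
  pose (T := fun u => g 1 + g1 1 * (u - 1) + g2 1 / 2 * (u - 1) ^ 2
                      + g3 1 / 6 * (u - 1) ^ 3).
  assert (Iv : forall u, unit_interval u ->
             is_RInt (fun t => pos_part (t - u) ^ 3 / 6 * g4 t) 0 1 (g u - T u)).
  { intros u Hu.
    pose (P := fun t => g t + g1 t * (u - t) + g2 t / 2 * (u - t) ^ 2
                        + g3 t / 6 * (u - t) ^ 3).
    assert (CP : forall t, continuous P t).
    { intros t; unfold P; continuity_solve. }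
    assert (IP : is_RInt (fun t => (u - t) ^ 3 / 6 * g4 t) u 1 (P 1 - P u)).
    { apply is_RInt_open_derive; [apply Hu | exact CP | |].
      - intros t; continuity_solve.
      - intros x Hx; destruct (HD x) as [D0 [D1 [D2 D3]]];
          [unfold unit_interval in Hu; lra|]; unfold P.
        auto_derive.
        + repeat split; eexists; eassumption.
        + rewrite (is_derive_unique (fun z : R => g z) x _ D0),
            (is_derive_unique (fun z : R => g1 z) x _ D1),
        (is_derive_unique (fun z : R => g2 z) x _ D2),
            (is_derive_unique (fun z : R => g3 z) x _ D3).
          simpl; field. }
    replace (g u - T u) with (plus 0 (scal (-1) (P 1 - P u))).
    2: { unfold plus, scal; simpl; unfold mult; simpl; unfold P, T; field. }
    refine (is_RInt_Chasles (V := R_NormedModule) _ 0 u 1 _ _ _ _).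
    - apply is_RInt_ext_open with (fun _ => 0); [apply Hu | |].
      + intros x Hx; rewrite pos_part_of_nonpos by lra; simpl; field.
      + apply is_RInt_zero.
    - apply is_RInt_ext_open with (fun t => -1 * ((u - t) ^ 3 / 6 * g4 t)); [apply Hu | |].
      + intros x Hx; rewrite pos_part_of_nonneg by lra; field.
      + apply (is_RInt_scal (fun t => (u - t) ^ 3 / 6 * g4 t)); exact IP. }
  assert (HT : Q T = H 1 - H 0).
  { rewrite (nodal_ext Q T (fun u => (g 1 - g1 1 + g2 1 / 2 - g3 1 / 6)
                + (g1 1 - g2 1 + g3 1 / 2) * u + (g2 1 / 2 - g3 1 / 2) * u ^ 2
                + g3 1 / 6 * u ^ 3) HQ) by (intros; unfold T; field).
    rewrite Hex; unfold H; field. }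
  assert (Hd : Q (fun u => g u - T u) = Q f - Q T).
  { rewrite (nodal_ext Q f (fun u => (g u - T u) + T u) HQ)
      by (intros u Hu; rewrite <- Hg by exact Hu; ring).
    rewrite (nodal_additive Q (fun u => g u - T u) T HQ); ring. }
  assert (Hrem : remainder Q f = V - Q (fun u => g u - T u))
    by (unfold remainder; rewrite Ig, Hd, HT; ring).
  rewrite Hrem.
  destruct HQ as [l [Hl E]].
  pose proof (is_RInt_weighted_sum l (fun u t => pos_part (t - u) ^ 3 / 6 * g4 t)
                (fun u => g u - T u) Hl Iv) as Il.
  rewrite <- E in Il.
  assert (Ew : forall t, weighted_sum l (fun u => pos_part (t - u) ^ 3 / 6 * g4 t)
                         = weighted_sum l (fun u => pos_part (t - u) ^ 3 / 6) * g4 t).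
  { intros t; clear; induction l as [|p l IH]; cbn [weighted_sum];
      [ring | rewrite IH; ring]. }
  eapply is_RInt_ext_open; [lra | | exact (is_RInt_minus _ _ _ _ _ _ If4 Il)].
  intros x _; unfold peano_kernel; rewrite Ew, <- Hg4, E.
  symmetry; apply Rmult_minus_distr_r.
Qed.

(** * Definiteness and the sign of the kernel *)

(** A continuous nonnegative function that is positive at one point of (0,1) has
    a positive integral. *)
Lemma RInt_pos_of_pos_at (h : R -> R) (x0 : R) :
  (forall x, continuous h x) -> (forall x, 0 <= x <= 1 -> 0 <= h x) ->
  0 < x0 < 1 -> 0 < h x0 -> 0 < RInt h 0 1.
Proof.
  intros Hc Hn Hx0 Hp.
  assert (Hex : forall a b, ex_RInt h a b)
    by (intros a b; eexists; apply is_RInt_of_continuous, Hc).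
  pose proof (proj2 (continuity_pt_filterlim h x0) (Hc x0)) as Hcx.
  destruct (Hcx (h x0) Hp) as [d [Hd Hlim]].
  pose (e := Rmin (d / 2) (Rmin x0 (1 - x0))).
  assert (He : 0 < e <= d / 2 /\ e <= x0 /\ e <= 1 - x0).
  { pose proof (Rmin_l (d / 2) (Rmin x0 (1 - x0))).
    pose proof (Rmin_r (d / 2) (Rmin x0 (1 - x0))).
    pose proof (Rmin_l x0 (1 - x0)); pose proof (Rmin_r x0 (1 - x0)).
    repeat split; try (unfold e; lra); unfold e; repeat apply Rmin_pos; lra. }
  rewrite <- (RInt_Chasles h 0 (x0 - e) 1) by apply Hex.
  rewrite <- (RInt_Chasles h (x0 - e) (x0 + e) 1) by apply Hex.
  unfold plus; simpl.
  assert (0 <= RInt h 0 (x0 - e)).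
  { apply RInt_ge_0; [lra | apply Hex | intros; apply Hn; lra]. }
  assert (0 <= RInt h (x0 + e) 1).
  { apply RInt_ge_0; [lra | apply Hex | intros; apply Hn; lra]. }
  assert (0 < RInt h (x0 - e) (x0 + e)); [|lra].
  apply RInt_gt_0; [lra | | intros; apply Hc].
  intros x Hx; destruct (Req_dec x x0) as [-> | Hne]; [exact Hp|].
  specialize (Hlim x); simpl in Hlim; unfold R_dist in Hlim.
  assert (Habs : Rabs (h x - h x0) < h x0).
  { apply Hlim; split; [split; [exact I | auto]|].
    unfold Rabs; destruct Rcase_abs; lra. }
  revert Habs; unfold Rabs; destruct Rcase_abs; lra.
Qed.

(** Weighted mean value theorem for integrals. *)
Lemma RInt_mean_value (h g : R -> R) (x0 : R) :
  (forall x, continuous h x) -> (forall x, continuous g x) ->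
  (forall x, 0 <= x <= 1 -> 0 <= h x) -> 0 < x0 < 1 -> 0 < h x0 ->
  exists xi, 0 <= xi <= 1 /\ RInt (fun x => h x * g x) 0 1 = RInt h 0 1 * g xi.
Proof.
  intros Hh Hg Hn Hx0 Hp.
  pose proof (RInt_pos_of_pos_at h x0 Hh Hn Hx0 Hp) as HI.
  assert (Hgc : continuity g) by (intros x; apply continuity_pt_filterlim, Hg).
  destruct (continuity_ab_min g 0 1) as [a [Ha Ha01]]; [lra | intros; apply Hgc|].
  destruct (continuity_ab_maj g 0 1) as [b [Hb Hb01]]; [lra | intros; apply Hgc|].
  set (I := RInt h 0 1) in *; set (J := RInt (fun x => h x * g x) 0 1).
  assert (HJ : is_RInt (fun x => h x * g x) 0 1 J)
    by (apply is_RInt_of_continuous; intros; apply continuous_mult_R; auto).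
  assert (HJc : forall c, is_RInt (fun x => c * h x) 0 1 (c * I)).
  { intros c; apply (is_RInt_scal h); apply is_RInt_of_continuous; exact Hh. }
  assert (Hlo : g a * I <= J).
  { apply (is_RInt_le (fun x => g a * h x) (fun x => h x * g x) 0 1);
      [lra | apply HJc | exact HJ |].
    intros x Hx; rewrite Rmult_comm.
    apply Rmult_le_compat_l; [apply Hn | apply Ha]; lra. }
  assert (Hhi : J <= g b * I).
  { apply (is_RInt_le (fun x => h x * g x) (fun x => g b * h x) 0 1);
      [lra | exact HJ | apply HJc |].
    intros x Hx; rewrite (Rmult_comm (g b)).
    apply Rmult_le_compat_l; [apply Hn | apply Hb]; lra. }
  assert (Hv : g a <= J / I <= g b).
  { split; [apply Rle_div_r | apply Rle_div_l]; lra. }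
  destruct (IVT_gen g a b (J / I) Hgc) as [xi [Hxi Exi]].
  { rewrite Rmin_left, Rmax_right by lra; exact Hv. }
  exists xi; split.
  - revert Hxi; unfold Rmin, Rmax; destruct Rle_dec; lra.
  - assert (E : forall u v : R, 0 < v -> u = v * (u / v)) by (intros; field; lra).
    rewrite Exi; exact (E J I HI).
Qed.

Lemma continuous_clamped_fourth_derivative (f f4 : R -> R) (x : R) :
  C4_with_fourth_derivative f f4 -> continuous (fun z => f4 (clamp z)) x.
Proof.
  intros [f1 [f2 [f3 H]]]; apply continuous_clamp; intros z Hz; apply H, Hz.
Qed.

Lemma positive_definite4_of_kernel (Q : functional) (x0 : R) :
  nodal Q -> exact_on_cubics Q ->
  (forall x, 0 <= x <= 1 -> 0 <= peano_kernel Q x) ->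
  0 < x0 < 1 -> 0 < peano_kernel Q x0 -> positive_definite4 Q.
Proof.
  intros HQ Hex Hn Hx0 Hp; split; [apply nodal_is_quadrature, HQ|].
  pose proof (fun x => continuous_peano_kernel Q x HQ) as Hc.
  exists (RInt (peano_kernel Q) 0 1); split.
  - exact (RInt_pos_of_pos_at _ x0 Hc Hn Hx0 Hp).
  - intros f f4 Hf.
    pose proof (fun x => continuous_clamped_fourth_derivative f f4 x Hf) as Hg.
    destruct (RInt_mean_value _ _ x0 Hc Hg Hn Hx0 Hp) as [xi [Hxi E]].
    exists xi; split; [exact Hxi|].
    rewrite clamp_id in E by exact Hxi; rewrite <- E; symmetry.
    apply is_RInt_unique, remainder_peano; assumption.
Qed.

Lemma negative_definite4_of_kernel (Q : functional) (x0 : R) :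
  nodal Q -> exact_on_cubics Q ->
  (forall x, 0 <= x <= 1 -> peano_kernel Q x <= 0) ->
  0 < x0 < 1 -> peano_kernel Q x0 < 0 -> negative_definite4 Q.
Proof.
  intros HQ Hex Hn Hx0 Hp; split; [apply nodal_is_quadrature, HQ|].
  pose (h := fun x => -1 * peano_kernel Q x).
  assert (Hc : forall x, continuous h x).
  { intros x; apply continuous_mult_R; [apply continuous_const|].
    apply continuous_peano_kernel, HQ. }
  assert (Hn' : forall x, 0 <= x <= 1 -> 0 <= h x)
    by (intros x Hx; unfold h; specialize (Hn x Hx); lra).
  assert (Hp' : 0 < h x0) by (unfold h; lra).
  exists (-1 * RInt h 0 1); split.
  - pose proof (RInt_pos_of_pos_at h x0 Hc Hn' Hx0 Hp'); lra.
  - intros f f4 Hf.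
    pose proof (fun x => continuous_clamped_fourth_derivative f f4 x Hf) as Hg.
    destruct (RInt_mean_value _ _ x0 Hc Hg Hn' Hx0 Hp') as [xi [Hxi E]].
    exists xi; split; [exact Hxi|].
    rewrite clamp_id in E by exact Hxi.
    rewrite Rmult_assoc, <- E.
    assert (Hr : RInt (fun x => h x * f4 (clamp x)) 0 1 = -1 * remainder Q f);
      [|rewrite Hr; ring].
    apply is_RInt_unique.
    apply is_RInt_ext_open with (fun x => -1 * (peano_kernel Q x * f4 (clamp x)));
      [lra | intros; unfold h; ring |].
    apply (is_RInt_scal (fun x => peano_kernel Q x * f4 (clamp x))).
    apply remainder_peano; assumption.
Qed.

Lemma is_derive_primitive (g : R -> R) (x : R) :
  (forall x, continuous g x) -> is_derive (fun z => RInt g 0 z) x (g x).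
Proof.
  intros Hg; apply is_derive_RInt with 0; [|apply Hg].
  apply filter_forall; intros z; apply is_RInt_of_continuous, Hg.
Qed.

Lemma D_in_of_is_derive (f f' : R -> R) (D : R -> Prop) (x : R) :
  is_derive f x (f' x) -> D_in f f' D x.
Proof.
  intros H eps Heps; apply is_derive_Reals in H.
  destruct (H eps Heps) as [d Hd].
  exists d; split; [apply cond_pos|]; intros z [[_ Hz] Hdist]; simpl in *.
  unfold R_dist in *; specialize (Hd (z - x) ltac:(lra) Hdist).
  replace (x + (z - x)) with z in Hd by ring; exact Hd.
Qed.

(** Every continuous function is a fourth derivative. *)
Lemma C4_fourfold_primitive (g : R -> R) :
  (forall x, continuous g x) -> exists f, C4_with_fourth_derivative f g.
Proof.
  intros H4.
  assert (Hstep : forall u : R -> R, (forall x, continuous u x) ->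
            forall x, continuous (fun z => RInt u 0 z) x).
  { intros u Hu x.
    apply (ex_derive_continuous (fun z => RInt u 0 z)).
    exists (u x); apply is_derive_primitive, Hu. }
  pose (f3 := fun z => RInt g 0 z).
  pose proof (Hstep g H4 : forall x, continuous f3 x) as H3.
  pose (f2 := fun z => RInt f3 0 z).
  pose proof (Hstep f3 H3 : forall x, continuous f2 x) as H2.
  pose (f1 := fun z => RInt f2 0 z).
  pose proof (Hstep f2 H2 : forall x, continuous f1 x) as H1.
  exists (fun z => RInt f1 0 z), f1, f2, f3; intros x _.
  repeat match goal with |- _ /\ _ => split end;
    try (apply D_in_of_is_derive, is_derive_primitive; assumption).
  intros eps Heps.
  destruct (proj2 (continuity_pt_filterlim g x) (H4 x) eps Heps) as [d [Hd Hlim]].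
  exists d; split; [exact Hd|]; intros z [[_ Hz] Hdist]; apply Hlim; repeat split; auto.
Qed.

(** The remainder of an [f] whose fourth derivative is the negative part of the
    kernel is minus the integral of the square of that negative part. *)
Lemma kernel_nonneg_of_positive_definite4 (Q : functional) (x : R) :
  nodal Q -> exact_on_cubics Q -> positive_definite4 Q -> 0 < x < 1 ->
  0 <= peano_kernel Q x.
Proof.
  intros HQ Hex [_ [c [Hc Hdef]]] Hx.
  destruct (Rle_lt_dec 0 (peano_kernel Q x)) as [|Hneg]; [assumption | exfalso].
  pose (g := fun t => pos_part (0 - peano_kernel Q t)).
  assert (Hg : forall t, continuous g t).
  { intros t; apply (continuous_comp (fun t => 0 - peano_kernel Q t) pos_part).
    - apply (continuous_minus (fun _ => 0) (peano_kernel Q));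
        [apply continuous_const | apply continuous_peano_kernel, HQ].
    - apply continuous_pos_part. }
  destruct (C4_fourfold_primitive g Hg) as [f Hf].
  destruct (Hdef f g Hf) as [xi [_ Hxi]].
  assert (0 <= g xi) by apply pos_part_nonneg.
  assert (Hpos : 0 < RInt (fun t => g t ^ 2) 0 1).
  { apply RInt_pos_of_pos_at with x;
      [intros; apply (continuous_pow 2 g); auto | | exact Hx |].
    - intros; apply pow2_ge_0.
    - apply pow_lt; unfold g; rewrite pos_part_of_nonneg; lra. }
  assert (Hint : RInt (fun t => g t ^ 2) 0 1 = -1 * remainder Q f).
  { apply is_RInt_unique.
    apply is_RInt_ext_open with (fun t => -1 * (peano_kernel Q t * g (clamp t)));
      [lra | |].
    - intros t Ht; rewrite clamp_id by (unfold unit_interval; lra); unfold g.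
      destruct (Rle_dec 0 (peano_kernel Q t)).
      + rewrite pos_part_of_nonpos by lra; ring.
      + rewrite pos_part_of_nonneg by lra; ring.
    - apply (is_RInt_scal (fun t => peano_kernel Q t * g (clamp t))).
      apply remainder_peano; assumption. }
  assert (0 <= c * g xi) by (apply Rmult_le_pos; lra).
  lra.
Qed.

(** * Sums of truncated cubes *)

Definition quartic (u : R) : R := u ^ 2 * (1 - u) ^ 2.

(** The 1-periodic extension of [quartic] from [0,1]: up to a constant, the
    periodic Bernoulli function of degree four. *)
Definition periodic (u : R) : R := quartic (frac_part u).

(** A discrete primitive of [4 * (pos_part u) ^ 3], see [beta_step]; it is bounded
    to the left because it is periodic there. *)
Definition beta (u : R) : R := if Rle_dec 0 u then quartic u else periodic u.

Lemma periodic_on (m : Z) (u : R) :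
  IZR m <= u <= IZR m + 1 -> periodic u = quartic (u - IZR m).
Proof.
  intros [H1 H2]; unfold periodic, frac_part.
  destruct (Rle_lt_or_eq_dec _ _ H2) as [Hlt | ->].
  - rewrite <- (Int_part_spec u m) by lra; reflexivity.
  - rewrite <- (Int_part_spec (IZR m + 1) (m + 1)%Z) by (rewrite plus_IZR; lra).
    rewrite plus_IZR; unfold quartic; ring.
Qed.

Lemma periodic_cell (u : R) : exists m : Z, IZR m <= u <= IZR m + 1.
Proof.
  exists (Int_part u); pose proof (base_Int_part u); lra.
Qed.

Lemma periodic_shift (m : Z) (u : R) : periodic (u + IZR m) = periodic u.
Proof.
  destruct (periodic_cell u) as [k Hk].
  rewrite (periodic_on k u Hk), (periodic_on (k + m)) by (rewrite plus_IZR; lra).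
  rewrite plus_IZR; f_equal; ring.
Qed.

Lemma periodic_shift_nat (m : nat) (u : R) : periodic (u - INR m) = periodic u.
Proof.
  rewrite <- (periodic_shift (Z.of_nat m)), <- INR_IZR_INZ; f_equal; ring.
Qed.

Lemma beta_of_nonneg (u : R) : 0 <= u -> beta u = quartic u.
Proof. intros; unfold beta; destruct Rle_dec; [reflexivity | lra]. Qed.

Lemma beta_of_le_1 (u : R) : u <= 1 -> beta u = periodic u.
Proof.
  intros; unfold beta; destruct Rle_dec; [|reflexivity].
  rewrite (periodic_on 0) by lra; f_equal; ring.
Qed.

Lemma beta_step (u : R) : 4 * pos_part u ^ 3 = beta (u + 1) - beta u.
Proof.
  destruct (Rle_dec 0 u).
  - rewrite pos_part_of_nonneg, !beta_of_nonneg by lra; unfold quartic; ring.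
  - rewrite pos_part_of_nonpos, !beta_of_le_1 by lra.
    rewrite (periodic_shift 1 u); ring.
Qed.

(** Makes the type of an equation between sums syntactically [R]. *)
Ltac equation_in_R := match goal with |- ?a = ?b => change (@eq R a b) end.

Lemma sum_telescope (u G : nat -> R) (p q : nat) :
  (p <= S q)%nat -> (forall k, u k = G (S k) - G k) ->
  sum_n_m u p q = G (S q) - G p.
Proof.
  intros Hpq Hu; induction q as [|q IH].
  - destruct (Nat.eq_dec p 0) as [-> | Hp].
    + rewrite sum_n_n; apply Hu.
    + replace p with 1%nat by lia; rewrite sum_n_m_zero by lia; unfold zero; simpl; ring.
  - destruct (Nat.eq_dec p (S (S q))) as [-> | Hp].
    + rewrite sum_n_m_zero by lia; unfold zero; simpl; ring.
    + rewrite sum_n_Sm, IH, Hu by lia; unfold plus; simpl; ring.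
Qed.

Lemma sum_reverse (u : nat -> R) (p q : nat) :
  sum_n_m (fun k => u (p + q - k)%nat) p q = sum_n_m u p q.
Proof.
  destruct (Nat.le_gt_cases p q) as [Hpq | Hpq];
    [|rewrite !sum_n_m_zero by lia; reflexivity].
  replace q with (p + (q - p))%nat by lia.
  generalize (q - p)%nat as d; clear q Hpq; intros d; revert u.
  induction d as [|d IH]; intros u.
  - rewrite Nat.add_0_r, !sum_n_n; f_equal; lia.
  - rewrite Nat.add_succ_r, (sum_n_Sm u) by lia.
    rewrite sum_Sn_m, <- sum_n_m_S by lia.
    replace (p + S (p + d) - p)%nat with (S (p + d)) by lia.
    rewrite <- IH; unfold plus; simpl; rewrite Rplus_comm; f_equal.
    apply sum_n_m_ext_loc; intros k Hk; f_equal; lia.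
Qed.

Lemma pos_part_div (u N : R) : 0 < N -> pos_part (u / N) = pos_part u / N.
Proof.
  intros HN; assert (0 < / N) by (apply Rinv_0_lt_compat, HN); unfold Rdiv.
  destruct (Rle_dec 0 u).
  - rewrite !pos_part_of_nonneg; [reflexivity | lra | apply Rmult_le_pos; lra].
  - rewrite (pos_part_of_nonpos u), pos_part_of_nonpos; [ring | | lra].
    apply Rmult_le_0_r; lra.
Qed.

Lemma truncated_power_scaled (N x u a : R) :
  0 < N -> N * u = a -> pos_part (x - u) ^ 3 / 6 = pos_part (N * x - a) ^ 3 / (6 * N ^ 3).
Proof.
  intros HN <-; replace (x - u) with ((N * x - N * u) / N) by (field; lra).
  rewrite pos_part_div by exact HN; field; lra.
Qed.

(** Of the symmetric pair [u], [1 - u] only [u] contributes as long as [x] is not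
    to the right of [1 - u]. *)
Lemma sigma_truncated_power (N x u a : R) :
  0 < N -> N * u = a -> N * x <= N - a ->
  Defs.sigma (fun u => pos_part (x - u) ^ 3 / 6) u = pos_part (N * x - a) ^ 3 / (6 * N ^ 3).
Proof.
  intros HN Hu Hx; unfold Defs.sigma.
  rewrite (truncated_power_scaled N x u a HN Hu).
  rewrite (truncated_power_scaled N x (1 - u) (N - a)) by (auto; rewrite <- Hu; ring).
  rewrite (pos_part_of_nonpos (N * x - (N - a))) by lra; field; lra.
Qed.

(** The hypothesis [N * x - INR q <= 1] says that the next node [(q + 1) / N] is
    not to the left of [x]; the sum then no longer depends on [q]. *)
Lemma sum_truncated_power_integers (N x : R) (p q : nat) :
  0 < N -> (p <= S q)%nat -> N * x - INR q <= 1 ->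
  sum_n_m (fun k => pos_part (x - INR k / N) ^ 3 / 6) p q =
  (beta (N * x - INR p + 1) - periodic (N * x)) / (24 * N ^ 3).
Proof.
  intros HN Hpq Hq; equation_in_R.
  rewrite (sum_telescope _ (fun k => - beta (N * x - INR k + 1) / (24 * N ^ 3)) p q Hpq).
  - rewrite S_INR; replace (N * x - (INR q + 1) + 1) with (N * x - INR q) by ring.
    rewrite (beta_of_le_1 _ Hq), periodic_shift_nat; field; lra.
  - intros k; rewrite (truncated_power_scaled N x _ (INR k)) by (auto; field; lra).
    rewrite S_INR; replace (N * x - (INR k + 1) + 1) with (N * x - INR k) by ring.
    pose proof (beta_step (N * x - INR k)) as E.
    replace (beta (N * x - INR k + 1))
      with (beta (N * x - INR k) + 4 * pos_part (N * x - INR k) ^ 3) by lra.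
    field; lra.
Qed.

(** The midpoints [y k n] are the points [k / n] moved by half a step. *)
Lemma sum_truncated_power_midpoints (n : nat) (x : R) (p q : nat) :
  (0 < n)%nat -> (p <= S q)%nat -> INR n * x - INR q <= 1 / 2 ->
  sum_n_m (fun k => pos_part (x - y k n) ^ 3 / 6) p q =
  (beta (INR n * x - INR p + 3 / 2) - periodic (INR n * x + 1 / 2)) / (24 * INR n ^ 3).
Proof.
  intros Hn Hpq Hq; assert (HN : 0 < INR n) by (apply lt_0_INR, Hn).
  pose proof (sum_truncated_power_integers (INR n) (x + 1 / (2 * INR n)) p q HN Hpq) as E.
  replace (INR n * (x + 1 / (2 * INR n))) with (INR n * x + 1 / 2) in E by (field; lra).
  replace (INR n * x - INR p + 3 / 2) with (INR n * x + 1 / 2 - INR p + 1) by field.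
  rewrite <- E by lra.
  apply sum_n_m_ext; intros k.
  replace (x - y k n) with (x + 1 / (2 * INR n) - INR k / INR n)
    by (unfold y; field; lra); reflexivity.
Qed.

(** Faulhaber's formula up to degree three. *)
Lemma sum_cubic_integers (c0 c1 c2 c3 N : R) (p q : nat) :
  0 < N -> (p <= S q)%nat ->
  let G t := c0 * t + c1 / N * (t * (t - 1) / 2)
             + c2 / N ^ 2 * (t * (t - 1) * (2 * t - 1) / 6)
             + c3 / N ^ 3 * (t ^ 2 * (t - 1) ^ 2 / 4) in
  sum_n_m (fun k => c0 + c1 * (INR k / N) + c2 * (INR k / N) ^ 2 + c3 * (INR k / N) ^ 3) p q
  = G (INR q + 1) - G (INR p).
Proof.
  intros HN Hpq G; rewrite <- S_INR; equation_in_R.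
  apply (sum_telescope _ (fun k => G (INR k))); [exact Hpq|].
  intros k; rewrite S_INR; unfold G; field; lra.
Qed.

Lemma sum_cubic_midpoints (c0 c1 c2 c3 : R) (n p q : nat) :
  (0 < n)%nat -> (p <= S q)%nat ->
  let N := INR n in
  let G t := c0 * t + c1 / N * (t ^ 2 / 2)
             + c2 / N ^ 2 * (t ^ 3 / 3 - t / 12)
             + c3 / N ^ 3 * (t ^ 4 / 4 - t ^ 2 / 8) in
  sum_n_m (fun k => c0 + c1 * y k n + c2 * y k n ^ 2 + c3 * y k n ^ 3) p q
  = G (INR q) - G (INR p - 1).
Proof.
  intros Hn Hpq N G; assert (HN : 0 < N) by (apply lt_0_INR, Hn); equation_in_R.
  rewrite (sum_telescope _ (fun k => G (INR k - 1)) p q Hpq).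
  - rewrite S_INR; do 2 f_equal; ring.
  - intros k; rewrite S_INR; unfold G, y; fold N; field; lra.
Qed.

(** * Scaled kernels of the five families *)

(** Invariance under the reflection of [0,1]. *)
Definition symmetric (Q : functional) : Prop :=
  forall f : R -> R, Q (fun x => f (1 - x)) = Q f.

(** [Q] is a symmetric rule of degree three whose kernel on the left half is
    [kappa (N x)] up to the factor [24 N^4]. *)
Record has_scaled_kernel (Q : functional) (N : R) (kappa : R -> R) : Prop := {
  hsk_nodal : nodal Q;
  hsk_exact : exact_on_cubics Q;
  hsk_symmetric : symmetric Q;
  hsk_kernel : forall x, 0 <= x <= 1 / 2 -> 24 * N ^ 4 * peano_kernel Q x = kappa (N * x)
}.

Lemma peano_kernel_symmetric (Q : functional) (t : R) :
  nodal Q -> exact_on_cubics Q -> symmetric Q ->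
  peano_kernel Q (1 - t) = peano_kernel Q t.
Proof.
  intros HQ Hex Hs; unfold peano_kernel.
  rewrite <- (Hs (fun u => pos_part (1 - t - u) ^ 3 / 6)).
  assert (E : Q (fun u => pos_part (t - u) ^ 3 / 6) =
    Q (fun u => t ^ 3 / 6 + - t ^ 2 / 2 * u + t / 2 * u ^ 2 + - 1 / 6 * u ^ 3)
    + Q (fun u => pos_part (1 - t - (1 - u)) ^ 3 / 6)).
  { rewrite <- nodal_additive by exact HQ; apply nodal_ext; [exact HQ|]; intros u _.
    pose proof (pos_part_minus_pos_opp_cubed (t - u)) as Hu.
    replace (1 - t - (1 - u)) with (- (t - u)) by ring.
    replace (pos_part (t - u) ^ 3) with ((t - u) ^ 3 + pos_part (- (t - u)) ^ 3) by lra; field. }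
  rewrite E, Hex; field.
Qed.

(** The scaled kernels of the five families. In each, the last difference is four
    times the sum of [pos_part (s - k) ^ 3] over all regular nodes [k] of the
    scaled formula, from the first one to infinity: the nodes are the integers for
    [kappa_3_1_1] and [kappa_3_1_3], and the half-integers for the others. *)
Definition kappa_3_1_1 (s : R) : R :=
  s ^ 4 - 4 * (403 / 1152 * pos_part s ^ 3 + 159 / 128 * pos_part (s - 1) ^ 3
               + 113 / 128 * pos_part (s - 2) ^ 3 + 1181 / 1152 * pos_part (s - 3) ^ 3)
  - (beta (s - 3) - periodic s).

Definition kappa_3_1_3 (s : R) : R :=
  s ^ 4 - 4 * (43 / 192 * pos_part s ^ 3 + 29 / 72 * pos_part (s - 1 / 2) ^ 3
               + 83 / 96 * pos_part (s - 1) ^ 3 + 581 / 576 * pos_part (s - 2) ^ 3)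
  - (beta (s - 2) - periodic s).

Definition kappa_3_2_1 (s : R) : R :=
  s ^ 4 - 4 * (13 / 72 * pos_part s ^ 3 + 1 / 2 * pos_part (s - 1 / 2) ^ 3
               + 4 / 9 * pos_part (s - 3 / 4) ^ 3 - 1 / 8 * pos_part (s - 1) ^ 3)
  - (beta (s - 1 / 2) - periodic (s + 1 / 2)).

Definition kappa_3_2_2 (s : R) : R :=
  s ^ 4 - 4 * (7 / 24 * pos_part s ^ 3 - 4 / 9 * pos_part (s - 1 / 4) ^ 3
               + 7 / 6 * pos_part (s - 1 / 2) ^ 3 - 1 / 72 * pos_part (s - 1) ^ 3)
  - (beta (s - 1 / 2) - periodic (s + 1 / 2)).

Definition kappa_3_2_3 (s : R) : R :=
  s ^ 4 - 4 * (11 / 12 * pos_part s ^ 3 - 3 / 2 * pos_part (s - 1 / 12) ^ 3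
               + 3 / 4 * pos_part (s - 1 / 6) ^ 3 - 1 / 6 * pos_part (s - 1 / 4) ^ 3)
  - (beta (s + 1 / 2) - periodic (s + 1 / 2)).

Lemma symmetric_sigma (f : R -> R) (x : R) :
  Defs.sigma (fun x => f (1 - x)) x = Defs.sigma f x.
Proof.
  unfold Defs.sigma; replace (1 - (1 - x)) with x by ring; ring.
Qed.

Lemma symmetric_sum_integers (f : R -> R) (n p : nat) :
  (0 < n)%nat ->
  sum_n_m (fun k => f (1 - INR k / INR n)) p (n - p) =
  sum_n_m (fun k => f (INR k / INR n)) p (n - p).
Proof.
  intros Hn; assert (0 < INR n) by (apply lt_0_INR, Hn).
  rewrite <- (sum_reverse (fun k => f (INR k / INR n))).
  apply sum_n_m_ext_loc; intros k Hk; f_equal.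
  replace (p + (n - p) - k)%nat with (n - k)%nat by lia.
  rewrite minus_INR by lia; field; lra.
Qed.

Lemma symmetric_sum_midpoints (f : R -> R) (n p : nat) :
  (0 < n)%nat ->
  sum_n_m (fun k => f (1 - y k n)) p (n + 1 - p) =
  sum_n_m (fun k => f (y k n)) p (n + 1 - p).
Proof.
  intros Hn; assert (0 < INR n) by (apply lt_0_INR, Hn).
  rewrite <- (sum_reverse (fun k => f (y k n))).
  apply sum_n_m_ext_loc; intros k Hk; f_equal; unfold y.
  replace (p + (n + 1 - p) - k)%nat with (n + 1 - k)%nat by lia.
  rewrite minus_INR, plus_INR by lia; simpl; field; lra.
Qed.

Ltac nodal_solve :=
  lazymatch goal with
  | |- nodal (fun f => _ + _) => apply nodal_plus; nodal_solve
  | |- nodal (fun f => _ - _) => apply nodal_minus; nodal_solve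
  | |- nodal (fun f => _ * _) => apply nodal_scal; nodal_solve
  | |- nodal (fun f => Defs.sigma f _) => apply nodal_sigma
  | |- nodal (fun f => sum_n_m _ _ _) => apply nodal_sum; intros
  end.

Lemma unit_interval_div (a N : R) : 0 < N -> 0 <= a <= N -> unit_interval (a / N).
Proof.
  intros HN Ha; split.
  - apply Rdiv_le_0_compat; lra.
  - apply Rle_div_l; lra.
Qed.

Lemma unit_interval_integer (n k : nat) :
  (0 < n)%nat -> (k <= n)%nat -> unit_interval (INR k / INR n).
Proof.
  intros Hn Hk; apply unit_interval_div; [apply lt_0_INR, Hn|].
  split; [apply pos_INR | apply le_INR, Hk].
Qed.

Lemma unit_interval_midpoint (n k : nat) :
  (1 <= k)%nat -> (k <= n)%nat -> unit_interval (y k n).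
Proof.
  intros H1 Hk; apply le_INR in H1; apply le_INR in Hk; simpl in H1.
  apply unit_interval_div; lra.
Qed.

(** Unfolds a formula applied to a function, leaving sums and [Defs.sigma]. *)
Ltac formula_unfold := cbn beta iota delta
  [formula Q_3_1_1 Q_3_1_3 Q_3_2_1 Q_3_2_2 Q_3_2_3].

(** The nodes of the boundary layer, given as [c / (d * n)]. *)
Ltac layer_node :=
  match goal with
  | |- unit_interval 0 => unfold unit_interval; lra
  | |- unit_interval (?a / (?d * ?N)) =>
      replace (a / (d * N)) with ((a / d) / N) by (field; lra);
      apply unit_interval_div; lra
  | |- unit_interval (?a / ?N) => apply unit_interval_div; lra
  end.

Lemma scaled_half_interval (N x : R) :
  0 < N -> 0 <= x <= 1 / 2 -> 0 <= N * x <= N / 2.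
Proof. intros; split; nra. Qed.

Lemma scaled_kernel_3_1_1 (n : nat) :
  (7 <= n)%nat -> has_scaled_kernel (formula Q_3_1_1 n) (INR n) kappa_3_1_1.
Proof.
  intros Hn; pose proof (le_INR _ _ Hn) as HN; simpl in HN.
  assert (HS : INR (n - 4) = INR n - 4) by (rewrite minus_INR by lia; simpl; ring).
  split.
  - formula_unfold; nodal_solve; try layer_node.
    apply unit_interval_integer; lia.
  - intros c0 c1 c2 c3; formula_unfold.
    rewrite sum_cubic_integers by (lia || lra); rewrite HS.
    unfold Defs.sigma; simpl INR; field; lra.
  - intros f; formula_unfold.
    rewrite !symmetric_sigma, symmetric_sum_integers by lia; reflexivity.
  - intros x Hx; unfold peano_kernel; formula_unfold.
    pose proof (scaled_half_interval (INR n) x ltac:(lra) Hx) as HNx.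
    rewrite (sigma_truncated_power (INR n) x 0 0) by (lra || (field; lra)).
    rewrite (sigma_truncated_power (INR n) x (1 / INR n) 1) by (lra || (field; lra)).
    rewrite (sigma_truncated_power (INR n) x (2 / INR n) 2) by (lra || (field; lra)).
    rewrite (sigma_truncated_power (INR n) x (3 / INR n) 3) by (lra || (field; lra)).
    rewrite sum_truncated_power_integers by (lia || lra).
    unfold kappa_3_1_1; simpl INR.
    replace (INR n * x - 0) with (INR n * x) by ring.
    replace (INR n * x - (1 + 1 + 1 + 1) + 1) with (INR n * x - 3) by ring.
    field; lra.
Qed.

Lemma scaled_kernel_3_1_3 (n : nat) :
  (5 <= n)%nat -> has_scaled_kernel (formula Q_3_1_3 n) (INR n) kappa_3_1_3.
Proof.
  intros Hn; pose proof (le_INR _ _ Hn) as HN; simpl in HN.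
  assert (HS : INR (n - 3) = INR n - 3) by (rewrite minus_INR by lia; simpl; ring).
  split.
  - formula_unfold; nodal_solve; try layer_node.
    apply unit_interval_integer; lia.
  - intros c0 c1 c2 c3; formula_unfold.
    rewrite sum_cubic_integers by (lia || lra); rewrite HS.
    unfold Defs.sigma; simpl INR; field; lra.
  - intros f; formula_unfold.
    rewrite !symmetric_sigma, symmetric_sum_integers by lia; reflexivity.
  - intros x Hx; unfold peano_kernel; formula_unfold.
    pose proof (scaled_half_interval (INR n) x ltac:(lra) Hx) as HNx.
    rewrite (sigma_truncated_power (INR n) x 0 0) by (lra || (field; lra)).
    rewrite (sigma_truncated_power (INR n) x (1 / (2 * INR n)) (1 / 2))
      by (lra || (field; lra)).
    rewrite (sigma_truncated_power (INR n) x (1 / INR n) 1) by (lra || (field; lra)).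
    rewrite (sigma_truncated_power (INR n) x (2 / INR n) 2) by (lra || (field; lra)).
    rewrite sum_truncated_power_integers by (lia || lra).
    unfold kappa_3_1_3; simpl INR.
    replace (INR n * x - 0) with (INR n * x) by ring.
    replace (INR n * x - (1 + 1 + 1) + 1) with (INR n * x - 2) by ring.
    field; lra.
Qed.

Lemma scaled_kernel_3_2_1 (n : nat) :
  (3 <= n)%nat -> has_scaled_kernel (formula Q_3_2_1 n) (INR n) kappa_3_2_1.
Proof.
  intros Hn; pose proof (le_INR _ _ Hn) as HN; simpl in HN.
  assert (HS : INR (n - 1) = INR n - 1) by (rewrite minus_INR by lia; simpl; ring).
  split.
  - formula_unfold; nodal_solve; try layer_node.
    apply unit_interval_midpoint; lia.
  - intros c0 c1 c2 c3; formula_unfold.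
    rewrite sum_cubic_midpoints by (lia || lra); rewrite HS.
    unfold Defs.sigma; simpl INR; field; lra.
  - intros f; formula_unfold.
    pose proof (symmetric_sum_midpoints f n 2 ltac:(lia)) as E.
    replace (n + 1 - 2)%nat with (n - 1)%nat in E by lia.
    rewrite !symmetric_sigma, E; reflexivity.
  - intros x Hx; unfold peano_kernel; formula_unfold.
    pose proof (scaled_half_interval (INR n) x ltac:(lra) Hx) as HNx.
    rewrite (sigma_truncated_power (INR n) x 0 0) by (lra || (field; lra)).
    rewrite (sigma_truncated_power (INR n) x (1 / (2 * INR n)) (1 / 2))
      by (lra || (field; lra)).
    rewrite (sigma_truncated_power (INR n) x (3 / (4 * INR n)) (3 / 4))
      by (lra || (field; lra)).
    rewrite (sigma_truncated_power (INR n) x (1 / INR n) 1) by (lra || (field; lra)).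
    rewrite sum_truncated_power_midpoints by (lia || lra).
    unfold kappa_3_2_1; simpl INR.
    replace (INR n * x - 0) with (INR n * x) by ring.
    replace (INR n * x - (1 + 1) + 3 / 2) with (INR n * x - 1 / 2) by field.
    field; lra.
Qed.

Lemma scaled_kernel_3_2_2 (n : nat) :
  (3 <= n)%nat -> has_scaled_kernel (formula Q_3_2_2 n) (INR n) kappa_3_2_2.
Proof.
  intros Hn; pose proof (le_INR _ _ Hn) as HN; simpl in HN.
  assert (HS : INR (n - 1) = INR n - 1) by (rewrite minus_INR by lia; simpl; ring).
  split.
  - formula_unfold; nodal_solve; try layer_node.
    apply unit_interval_midpoint; lia.
  - intros c0 c1 c2 c3; formula_unfold.
    rewrite sum_cubic_midpoints by (lia || lra); rewrite HS.
    unfold Defs.sigma; simpl INR; field; lra.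
  - intros f; formula_unfold.
    pose proof (symmetric_sum_midpoints f n 2 ltac:(lia)) as E.
    replace (n + 1 - 2)%nat with (n - 1)%nat in E by lia.
    rewrite !symmetric_sigma, E; reflexivity.
  - intros x Hx; unfold peano_kernel; formula_unfold.
    pose proof (scaled_half_interval (INR n) x ltac:(lra) Hx) as HNx.
    rewrite (sigma_truncated_power (INR n) x 0 0) by (lra || (field; lra)).
    rewrite (sigma_truncated_power (INR n) x (1 / (4 * INR n)) (1 / 4))
      by (lra || (field; lra)).
    rewrite (sigma_truncated_power (INR n) x (1 / (2 * INR n)) (1 / 2))
      by (lra || (field; lra)).
    rewrite (sigma_truncated_power (INR n) x (1 / INR n) 1) by (lra || (field; lra)).
    rewrite sum_truncated_power_midpoints by (lia || lra).
    unfold kappa_3_2_2; simpl INR.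
    replace (INR n * x - 0) with (INR n * x) by ring.
    replace (INR n * x - (1 + 1) + 3 / 2) with (INR n * x - 1 / 2) by field.
    field; lra.
Qed.

Lemma scaled_kernel_3_2_3 (n : nat) :
  (1 <= n)%nat -> has_scaled_kernel (formula Q_3_2_3 n) (INR n) kappa_3_2_3.
Proof.
  intros Hn; pose proof (le_INR _ _ Hn) as HN; simpl in HN.
  split.
  - formula_unfold; nodal_solve; try layer_node.
    apply unit_interval_midpoint; lia.
  - intros c0 c1 c2 c3; formula_unfold.
    rewrite sum_cubic_midpoints by (lia || lra).
    unfold Defs.sigma; simpl INR; field; lra.
  - intros f; formula_unfold.
    pose proof (symmetric_sum_midpoints f n 1 ltac:(lia)) as E.
    replace (n + 1 - 1)%nat with n in E by lia.
    rewrite !symmetric_sigma, E; reflexivity.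
  - intros x Hx; unfold peano_kernel; formula_unfold.
    pose proof (scaled_half_interval (INR n) x ltac:(lra) Hx) as HNx.
    rewrite (sigma_truncated_power (INR n) x 0 0) by (lra || (field; lra)).
    rewrite (sigma_truncated_power (INR n) x (1 / (12 * INR n)) (1 / 12))
      by (lra || (field; lra)).
    rewrite (sigma_truncated_power (INR n) x (1 / (6 * INR n)) (1 / 6))
      by (lra || (field; lra)).
    rewrite (sigma_truncated_power (INR n) x (1 / (4 * INR n)) (1 / 4))
      by (lra || (field; lra)).
    rewrite sum_truncated_power_midpoints by (lia || lra).
    unfold kappa_3_2_3; simpl INR.
    replace (INR n * x - 0) with (INR n * x) by ring.
    replace (INR n * x - 1 + 3 / 2) with (INR n * x + 1 / 2) by field.
    field; lra.
Qed.

(** * Signs of the scaled kernels *)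

(** The Bernstein basis of degree four on the interval from [a] to [b], up to
    positive factors. *)
Lemma bernstein_basis_nonneg (a b x : R) :
  a <= x <= b ->
  0 <= (x - a) ^ 4 /\ 0 <= (x - a) ^ 3 * (b - x) /\ 0 <= (x - a) ^ 2 * (b - x) ^ 2 /\
  0 <= (x - a) * (b - x) ^ 3 /\ 0 <= (b - x) ^ 4.
Proof.
  intros Hx; repeat split; repeat apply Rmult_le_pos; try apply pow_le; lra.
Qed.

(** A quartic inequality in [x] on the interval from [a] to [b] follows linearly
    from the nonnegativity of the Bernstein basis when the Bernstein coefficients
    of the difference are nonnegative. *)
Ltac bernstein a b x :=
  let H := fresh in
  assert (H : a <= x <= b) by lra;
  apply bernstein_basis_nonneg in H;
  destruct H as [? [? [? [? ?]]]]; lra.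

Ltac resolve_pos_part :=
  repeat match goal with
  | |- context [pos_part ?u] =>
      first [ rewrite (pos_part_of_nonneg u) by lra
            | rewrite (pos_part_of_nonpos u) by lra ]
  end.

(** Runs [tac u v] for consecutive breakpoints [u] and [v] of [a :: l], with [x]
    between [u] and [v]. *)
Ltac on_pieces x a l tac :=
  lazymatch l with
  | ?b :: ?l' => destruct (Rle_lt_dec x b); [tac a b | on_pieces x b l' tac]
  | [] => exfalso; lra
  end.

(** No regular node has been passed yet. *)
Lemma beta_minus_periodic (u v : R) (m : Z) :
  u <= 1 -> v = u + IZR m -> beta u - periodic v = 0.
Proof. intros Hu ->; rewrite (beta_of_le_1 u Hu), periodic_shift; ring. Qed.

Lemma periodic_le (u : R) : periodic u <= 1 / 16.
Proof.
  destruct (periodic_cell u) as [m Hm]; rewrite (periodic_on m u Hm); unfold quartic.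
  assert (Hv : 0 <= u - IZR m <= 1) by lra; revert Hv; generalize (u - IZR m); intros v Hv.
  on_pieces v 0 [1 / 2; 1] ltac:(fun a b => bernstein a b v).
Qed.

(** [periodic (u + 1 / 2) - 1 / 16] in terms of the signed distance from [u] to
    the nearest integer [m]. *)
Lemma periodic_midpoint_cell (m : Z) (u : R) :
  IZR m - 1 / 2 <= u <= IZR m + 1 / 2 ->
  periodic (u + 1 / 2) - 1 / 16 = - ((u - IZR m) ^ 2 * (1 / 2 - (u - IZR m) ^ 2)).
Proof.
  intros Hu; rewrite (periodic_on m) by lra; unfold quartic; field.
Qed.

Lemma periodic_midpoint_double (s : R) :
  1 / 16 - periodic (2 * s + 1 / 2) <= 4 * (1 / 16 - periodic (s + 1 / 2)).
Proof.
  destruct (periodic_cell (s + 1 / 2)) as [m Hm].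
  assert (E : s = (s - IZR m) + IZR m) by ring; revert E.
  assert (Hv : - (1 / 2) <= s - IZR m <= 1 / 2) by lra; revert Hv.
  generalize (s - IZR m); intros v Hv ->.
  replace (v + IZR m + 1 / 2) with (v + 1 / 2 + IZR m) by ring.
  replace (2 * (v + IZR m) + 1 / 2) with (2 * v + 1 / 2 + IZR (2 * m))
    by (rewrite mult_IZR; ring).
  rewrite !periodic_shift.
  pose proof (periodic_midpoint_cell 0 v ltac:(lra)) as E1.
  destruct (Rle_lt_dec v (- (1 / 4))).
  - pose proof (periodic_midpoint_cell (-1) (2 * v) ltac:(lra)) as E2.
    bernstein (- (1 / 2)) (- (1 / 4)) v.
  - destruct (Rle_lt_dec v (1 / 4)).
    + pose proof (periodic_midpoint_cell 0 (2 * v) ltac:(lra)) as E2.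
      pose proof (pow2_ge_0 (v ^ 2)); lra.
    + pose proof (periodic_midpoint_cell 1 (2 * v) ltac:(lra)) as E2.
      bernstein (1 / 4) (1 / 2) v.
Qed.

(** Away from the boundary layers every [c >= 1/3] works, whether the coarse
    formula has its regular nodes at the midpoints or at the integers. *)
Lemma hat_interior_midpoints (c s : R) :
  1 / 3 <= c ->
  0 <= (c + 1) * (periodic (2 * s + 1 / 2) - 1 / 16)
       - 16 * c * (periodic (s + 1 / 2) - 1 / 16).
Proof.
  intros Hc; pose proof (periodic_midpoint_double s); pose proof (periodic_le (s + 1 / 2)).
  nra.
Qed.

Lemma hat_interior_integers (c s : R) :
  1 / 3 <= c ->
  0 <= (c + 1) * (periodic (2 * s + 1 / 2) - 1 / 16) - 16 * c * (periodic s - 1 / 16).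
Proof.
  intros Hc; pose proof (hat_interior_midpoints c (s - 1 / 2) Hc) as H.
  replace (2 * (s - 1 / 2) + 1 / 2) with (2 * s + 1 / 2 + IZR (-1)) in H by lra.
  rewrite periodic_shift in H.
  replace (s - 1 / 2 + 1 / 2) with s in H by ring; exact H.
Qed.

Lemma kappa_3_1_1_layer (s : R) :
  s <= 4 ->
  kappa_3_1_1 s =
  s ^ 4 - 4 * (403 / 1152 * pos_part s ^ 3 + 159 / 128 * pos_part (s - 1) ^ 3
               + 113 / 128 * pos_part (s - 2) ^ 3 + 1181 / 1152 * pos_part (s - 3) ^ 3).
Proof.
  intros Hs; unfold kappa_3_1_1; rewrite (beta_minus_periodic _ _ 3) by lra; ring.
Qed.

Lemma kappa_3_1_1_interior (s : R) :
  3 <= s -> kappa_3_1_1 s = periodic s - 1 / 16.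
Proof.
  intros Hs; unfold kappa_3_1_1; rewrite beta_of_nonneg by lra.
  resolve_pos_part; unfold quartic; field.
Qed.

Lemma kappa_3_1_1_near_0 (s : R) :
  0 <= s <= 1 / 12 -> kappa_3_1_1 s = s ^ 4 - 4 * (403 / 1152) * s ^ 3.
Proof.
  intros Hs; rewrite kappa_3_1_1_layer by lra; resolve_pos_part; field.
Qed.

Lemma kappa_3_1_1_nonpos (s : R) : 0 <= s -> kappa_3_1_1 s <= 0.
Proof.
  intros Hs; destruct (Rle_lt_dec (3) s).
  - rewrite kappa_3_1_1_interior by lra; pose proof (periodic_le s); lra.
  - rewrite kappa_3_1_1_layer by lra.
    on_pieces s 0 [1 / 2; 1; 3 / 2; 2; 5 / 2; 3]
      ltac:(fun a b => resolve_pos_part; bernstein a b s).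
Qed.

Lemma kappa_3_1_3_layer (s : R) :
  s <= 3 ->
  kappa_3_1_3 s =
  s ^ 4 - 4 * (43 / 192 * pos_part s ^ 3 + 29 / 72 * pos_part (s - 1 / 2) ^ 3
               + 83 / 96 * pos_part (s - 1) ^ 3 + 581 / 576 * pos_part (s - 2) ^ 3).
Proof.
  intros Hs; unfold kappa_3_1_3; rewrite (beta_minus_periodic _ _ 2) by lra; ring.
Qed.

Lemma kappa_3_1_3_interior (s : R) :
  2 <= s -> kappa_3_1_3 s = periodic s - 1 / 16.
Proof.
  intros Hs; unfold kappa_3_1_3; rewrite beta_of_nonneg by lra.
  resolve_pos_part; unfold quartic; field.
Qed.

Lemma kappa_3_1_3_near_0 (s : R) :
  0 <= s <= 1 / 12 -> kappa_3_1_3 s = s ^ 4 - 4 * (43 / 192) * s ^ 3.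
Proof.
  intros Hs; rewrite kappa_3_1_3_layer by lra; resolve_pos_part; field.
Qed.

Lemma kappa_3_1_3_nonpos (s : R) : 0 <= s -> kappa_3_1_3 s <= 0.
Proof.
  intros Hs; destruct (Rle_lt_dec (2) s).
  - rewrite kappa_3_1_3_interior by lra; pose proof (periodic_le s); lra.
  - rewrite kappa_3_1_3_layer by lra.
    on_pieces s 0 [1 / 2; 1; 3 / 2; 2]
      ltac:(fun a b => resolve_pos_part; bernstein a b s).
Qed.

Lemma kappa_3_2_1_layer (s : R) :
  s <= 3 / 2 ->
  kappa_3_2_1 s =
  s ^ 4 - 4 * (13 / 72 * pos_part s ^ 3 + 1 / 2 * pos_part (s - 1 / 2) ^ 3
               + 4 / 9 * pos_part (s - 3 / 4) ^ 3 - 1 / 8 * pos_part (s - 1) ^ 3).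
Proof.
  intros Hs; unfold kappa_3_2_1; rewrite (beta_minus_periodic _ _ 1) by lra; ring.
Qed.

Lemma kappa_3_2_1_interior (s : R) :
  1 <= s -> kappa_3_2_1 s = periodic (s + 1 / 2) - 1 / 16.
Proof.
  intros Hs; unfold kappa_3_2_1; rewrite beta_of_nonneg by lra.
  resolve_pos_part; unfold quartic; field.
Qed.

Lemma kappa_3_2_1_near_0 (s : R) :
  0 <= s <= 1 / 12 -> kappa_3_2_1 s = s ^ 4 - 4 * (13 / 72) * s ^ 3.
Proof.
  intros Hs; rewrite kappa_3_2_1_layer by lra; resolve_pos_part; field.
Qed.

Lemma kappa_3_2_1_nonpos (s : R) : 0 <= s -> kappa_3_2_1 s <= 0.
Proof.
  intros Hs; destruct (Rle_lt_dec (1) s).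
  - rewrite kappa_3_2_1_interior by lra; pose proof (periodic_le (s + 1 / 2)); lra.
  - rewrite kappa_3_2_1_layer by lra.
    on_pieces s 0 [1 / 2; 3 / 4; 1]
      ltac:(fun a b => resolve_pos_part; bernstein a b s).
Qed.

Lemma kappa_3_2_2_layer (s : R) :
  s <= 3 / 2 ->
  kappa_3_2_2 s =
  s ^ 4 - 4 * (7 / 24 * pos_part s ^ 3 - 4 / 9 * pos_part (s - 1 / 4) ^ 3
               + 7 / 6 * pos_part (s - 1 / 2) ^ 3 - 1 / 72 * pos_part (s - 1) ^ 3).
Proof.
  intros Hs; unfold kappa_3_2_2; rewrite (beta_minus_periodic _ _ 1) by lra; ring.
Qed.

Lemma kappa_3_2_2_interior (s : R) :
  1 <= s -> kappa_3_2_2 s = periodic (s + 1 / 2) - 1 / 16.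
Proof.
  intros Hs; unfold kappa_3_2_2; rewrite beta_of_nonneg by lra.
  resolve_pos_part; unfold quartic; field.
Qed.

Lemma kappa_3_2_2_near_0 (s : R) :
  0 <= s <= 1 / 12 -> kappa_3_2_2 s = s ^ 4 - 4 * (7 / 24) * s ^ 3.
Proof.
  intros Hs; rewrite kappa_3_2_2_layer by lra; resolve_pos_part; field.
Qed.

Lemma kappa_3_2_2_nonpos (s : R) : 0 <= s -> kappa_3_2_2 s <= 0.
Proof.
  intros Hs; destruct (Rle_lt_dec (1) s).
  - rewrite kappa_3_2_2_interior by lra; pose proof (periodic_le (s + 1 / 2)); lra.
  - rewrite kappa_3_2_2_layer by lra.
    on_pieces s 0 [1 / 4; 1 / 2; 1]
      ltac:(fun a b => resolve_pos_part; bernstein a b s).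
Qed.

Lemma kappa_3_2_3_layer (s : R) :
  s <= 1 / 2 ->
  kappa_3_2_3 s =
  s ^ 4 - 4 * (11 / 12 * pos_part s ^ 3 - 3 / 2 * pos_part (s - 1 / 12) ^ 3
               + 3 / 4 * pos_part (s - 1 / 6) ^ 3 - 1 / 6 * pos_part (s - 1 / 4) ^ 3).
Proof.
  intros Hs; unfold kappa_3_2_3; rewrite (beta_minus_periodic _ _ 0) by lra; ring.
Qed.

Lemma kappa_3_2_3_interior (s : R) :
  1 / 4 <= s -> kappa_3_2_3 s = periodic (s + 1 / 2) - 1 / 16.
Proof.
  intros Hs; unfold kappa_3_2_3; rewrite beta_of_nonneg by lra.
  resolve_pos_part; unfold quartic; field.
Qed.

Lemma kappa_3_2_3_near_0 (s : R) :
  0 <= s <= 1 / 12 -> kappa_3_2_3 s = s ^ 4 - 4 * (11 / 12) * s ^ 3.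
Proof.
  intros Hs; rewrite kappa_3_2_3_layer by lra; resolve_pos_part; field.
Qed.

Lemma kappa_3_2_3_nonpos (s : R) : 0 <= s -> kappa_3_2_3 s <= 0.
Proof.
  intros Hs; destruct (Rle_lt_dec (1 / 4) s).
  - rewrite kappa_3_2_3_interior by lra; pose proof (periodic_le (s + 1 / 2)); lra.
  - rewrite kappa_3_2_3_layer by lra.
    on_pieces s 0 [1 / 12; 1 / 6; 1 / 4]
      ltac:(fun a b => resolve_pos_part; bernstein a b s).
Qed.

(** Replaces the interior part of a midpoint kernel at [u] by its polynomial. *)
Ltac resolve_midpoint_cell u :=
  first [ rewrite (periodic_midpoint_cell 1 u) by lra
        | rewrite (periodic_midpoint_cell 2 u) by lra
        | rewrite (periodic_midpoint_cell 3 u) by lra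
        | rewrite (periodic_midpoint_cell 4 u) by lra
        | rewrite (periodic_midpoint_cell 5 u) by lra
        | rewrite (periodic_midpoint_cell 6 u) by lra ].

(** The kernel of [(c + 1) Q' - c Q''], up to a positive factor, at [s = n x],
    where [Q'] is taken at [2 n] and [Q''] at [n]. *)
Definition hat_kernel (c : R) (kappa' kappa'' : R -> R) (s : R) : R :=
  (c + 1) * kappa' (2 * s) - 16 * c * kappa'' s.

Lemma hat_kernel_3_2_1_3_1_1 (s : R) :
  0 <= s -> 0 <= hat_kernel (104 / 299) kappa_3_2_1 kappa_3_1_1 s.
Proof.
  intros Hs; unfold hat_kernel; destruct (Rle_lt_dec s (1 / 2)).
  - rewrite kappa_3_2_1_layer, kappa_3_1_1_layer by lra.
    on_pieces s 0 [1 / 4; 3 / 8; 1 / 2]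
      ltac:(fun a b => resolve_pos_part; bernstein a b s).
  - rewrite kappa_3_2_1_interior by lra; destruct (Rle_lt_dec s 3).
    + rewrite kappa_3_1_1_layer by lra.
      on_pieces s (1 / 2) [3 / 4; 1; 5 / 4; 3 / 2; 7 / 4; 2; 9 / 4; 5 / 2; 11 / 4; 3]
        ltac:(fun a b => resolve_midpoint_cell (2 * s); resolve_pos_part; bernstein a b s).
    + rewrite kappa_3_1_1_interior by lra; apply hat_interior_integers; lra.
Qed.

Lemma hat_kernel_3_2_1_3_1_3 (s : R) :
  0 <= s -> 0 <= hat_kernel (52 / 77) kappa_3_2_1 kappa_3_1_3 s.
Proof.
  intros Hs; unfold hat_kernel; destruct (Rle_lt_dec s (1 / 2)).
  - rewrite kappa_3_2_1_layer, kappa_3_1_3_layer by lra.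
    on_pieces s 0 [1 / 4; 3 / 8; 1 / 2]
      ltac:(fun a b => resolve_pos_part; bernstein a b s).
  - rewrite kappa_3_2_1_interior by lra; destruct (Rle_lt_dec s 2).
    + rewrite kappa_3_1_3_layer by lra.
      on_pieces s (1 / 2) [3 / 4; 1; 5 / 4; 3 / 2; 7 / 4; 2]
        ltac:(fun a b => resolve_midpoint_cell (2 * s); resolve_pos_part; bernstein a b s).
    + rewrite kappa_3_1_3_interior by lra; apply hat_interior_integers; lra.
Qed.

Lemma hat_kernel_3_2_1_3_2_1 (s : R) :
  0 <= s -> 0 <= hat_kernel 1 kappa_3_2_1 kappa_3_2_1 s.
Proof.
  intros Hs; unfold hat_kernel; destruct (Rle_lt_dec s (1 / 2)).
  - rewrite kappa_3_2_1_layer, kappa_3_2_1_layer by lra.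
    on_pieces s 0 [1 / 4; 3 / 8; 1 / 2]
      ltac:(fun a b => resolve_pos_part; bernstein a b s).
  - rewrite kappa_3_2_1_interior by lra; destruct (Rle_lt_dec s 1).
    + rewrite kappa_3_2_1_layer by lra.
      on_pieces s (1 / 2) [3 / 4; 1]
        ltac:(fun a b => resolve_midpoint_cell (2 * s); resolve_pos_part; bernstein a b s).
    + rewrite kappa_3_2_1_interior by lra; apply hat_interior_midpoints; lra.
Qed.

Lemma hat_kernel_3_2_1_3_2_2 (s : R) :
  0 <= s -> 0 <= hat_kernel (13 / 29) kappa_3_2_1 kappa_3_2_2 s.
Proof.
  intros Hs; unfold hat_kernel; destruct (Rle_lt_dec s (1 / 2)).
  - rewrite kappa_3_2_1_layer, kappa_3_2_2_layer by lra.
    on_pieces s 0 [1 / 4; 3 / 8; 1 / 2]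
      ltac:(fun a b => resolve_pos_part; bernstein a b s).
  - rewrite kappa_3_2_1_interior by lra; destruct (Rle_lt_dec s 1).
    + rewrite kappa_3_2_2_layer by lra.
      on_pieces s (1 / 2) [3 / 4; 1]
        ltac:(fun a b => resolve_midpoint_cell (2 * s); resolve_pos_part; bernstein a b s).
    + rewrite kappa_3_2_2_interior by lra; apply hat_interior_midpoints; lra.
Qed.

Lemma hat_kernel_3_2_1_3_2_3 (s : R) :
  0 <= s -> 0 <= hat_kernel (1 / 3) kappa_3_2_1 kappa_3_2_3 s.
Proof.
  intros Hs; unfold hat_kernel; destruct (Rle_lt_dec s (1 / 2)).
  - rewrite kappa_3_2_1_layer, kappa_3_2_3_layer by lra.
    on_pieces s 0 [1 / 12; 1 / 6; 1 / 4; 3 / 8; 1 / 2]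
      ltac:(fun a b => resolve_pos_part; bernstein a b s).
  - rewrite kappa_3_2_1_interior, kappa_3_2_3_interior by lra.
    apply hat_interior_midpoints; lra.
Qed.

Lemma hat_kernel_3_2_2_3_1_1 (s : R) :
  0 <= s -> 0 <= hat_kernel (168 / 235) kappa_3_2_2 kappa_3_1_1 s.
Proof.
  intros Hs; unfold hat_kernel; destruct (Rle_lt_dec s (1 / 2)).
  - rewrite kappa_3_2_2_layer, kappa_3_1_1_layer by lra.
    on_pieces s 0 [1 / 8; 1 / 4; 1 / 2]
      ltac:(fun a b => resolve_pos_part; bernstein a b s).
  - rewrite kappa_3_2_2_interior by lra; destruct (Rle_lt_dec s 3).
    + rewrite kappa_3_1_1_layer by lra.
      on_pieces s (1 / 2) [3 / 4; 1; 5 / 4; 3 / 2; 7 / 4; 2; 9 / 4; 5 / 2; 11 / 4; 3]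
        ltac:(fun a b => resolve_midpoint_cell (2 * s); resolve_pos_part; bernstein a b s).
    + rewrite kappa_3_1_1_interior by lra; apply hat_interior_integers; lra.
Qed.

Lemma hat_kernel_3_2_2_3_1_3 (s : R) :
  0 <= s -> 0 <= hat_kernel (28 / 15) kappa_3_2_2 kappa_3_1_3 s.
Proof.
  intros Hs; unfold hat_kernel; destruct (Rle_lt_dec s (1 / 2)).
  - rewrite kappa_3_2_2_layer, kappa_3_1_3_layer by lra.
    on_pieces s 0 [1 / 8; 1 / 4; 1 / 2]
      ltac:(fun a b => resolve_pos_part; bernstein a b s).
  - rewrite kappa_3_2_2_interior by lra; destruct (Rle_lt_dec s 2).
    + rewrite kappa_3_1_3_layer by lra.
      on_pieces s (1 / 2) [3 / 4; 1; 5 / 4; 3 / 2; 7 / 4; 2]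
        ltac:(fun a b => resolve_midpoint_cell (2 * s); resolve_pos_part; bernstein a b s).
    + rewrite kappa_3_1_3_interior by lra; apply hat_interior_integers; lra.
Qed.

Lemma hat_kernel_3_2_2_3_2_2 (s : R) :
  0 <= s -> 0 <= hat_kernel 1 kappa_3_2_2 kappa_3_2_2 s.
Proof.
  intros Hs; unfold hat_kernel; destruct (Rle_lt_dec s (1 / 2)).
  - rewrite kappa_3_2_2_layer, kappa_3_2_2_layer by lra.
    on_pieces s 0 [1 / 8; 1 / 4; 1 / 2]
      ltac:(fun a b => resolve_pos_part; bernstein a b s).
  - rewrite kappa_3_2_2_interior by lra; destruct (Rle_lt_dec s 1).
    + rewrite kappa_3_2_2_layer by lra.
      on_pieces s (1 / 2) [3 / 4; 1]
        ltac:(fun a b => resolve_midpoint_cell (2 * s); resolve_pos_part; bernstein a b s).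
    + rewrite kappa_3_2_2_interior by lra; apply hat_interior_midpoints; lra.
Qed.

Lemma hat_kernel_3_2_2_3_2_3 (s : R) :
  0 <= s -> 0 <= hat_kernel (1 / 3) kappa_3_2_2 kappa_3_2_3 s.
Proof.
  intros Hs; unfold hat_kernel; destruct (Rle_lt_dec s (1 / 2)).
  - rewrite kappa_3_2_2_layer, kappa_3_2_3_layer by lra.
    on_pieces s 0 [1 / 12; 1 / 8; 1 / 6; 1 / 4; 1 / 2]
      ltac:(fun a b => resolve_pos_part; bernstein a b s).
  - rewrite kappa_3_2_2_interior, kappa_3_2_3_interior by lra.
    apply hat_interior_midpoints; lra.
Qed.

Lemma hat_kernel_3_2_3_3_2_3 (s : R) :
  0 <= s -> 0 <= hat_kernel 1 kappa_3_2_3 kappa_3_2_3 s.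
Proof.
  intros Hs; unfold hat_kernel; destruct (Rle_lt_dec s (1 / 4)).
  - rewrite kappa_3_2_3_layer, kappa_3_2_3_layer by lra.
    on_pieces s 0 [1 / 24; 1 / 12; 1 / 8; 1 / 6; 1 / 4]
      ltac:(fun a b => resolve_pos_part; bernstein a b s).
  - rewrite kappa_3_2_3_interior, kappa_3_2_3_interior by lra.
    apply hat_interior_midpoints; lra.
Qed.

(** * Definiteness and the smallest constant *)

(** [a] is the weight at the end point, in units of the step; [1 / 12] bounds the
    first positive node of all five families from below, and [1 / 48 < a] makes
    [kappa (1 / 12)] negative. *)
Definition end_weight (kappa : R -> R) (a : R) : Prop :=
  1 / 48 < a /\ forall s, 0 <= s <= 1 / 12 -> kappa s = s ^ 4 - 4 * a * s ^ 3.

(** On the left half of [0,1] the kernel and [kappa] have the same sign. *)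
Lemma scaled_kernel_sign (Q : functional) (N : R) (kappa : R -> R) (x : R) :
  0 < N -> has_scaled_kernel Q N kappa -> 0 <= x <= 1 / 2 ->
  (0 < kappa (N * x) -> 0 < peano_kernel Q x) /\
  (0 <= kappa (N * x) -> 0 <= peano_kernel Q x) /\
  (kappa (N * x) < 0 -> peano_kernel Q x < 0) /\
  (kappa (N * x) <= 0 -> peano_kernel Q x <= 0) /\
  (0 <= peano_kernel Q x -> 0 <= kappa (N * x)).
Proof.
  intros HN HQ Hx; rewrite <- (hsk_kernel _ _ _ HQ x Hx).
  assert (0 < 24 * N ^ 4) by (apply Rmult_lt_0_compat; [lra | apply pow_lt, HN]).
  repeat split; intros; nra.
Qed.

Lemma scaled_kernel_fold (Q : functional) (N : R) (kappa : R -> R) (x : R) :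
  has_scaled_kernel Q N kappa -> peano_kernel Q (1 - x) = peano_kernel Q x.
Proof. intros [H1 H2 H3 _]; apply peano_kernel_symmetric; assumption. Qed.

Lemma negative_definite4_of_scaled (Q : functional) (N a : R) (kappa : R -> R) :
  1 <= N -> has_scaled_kernel Q N kappa -> end_weight kappa a ->
  (forall s, 0 <= s -> kappa s <= 0) -> negative_definite4 Q.
Proof.
  intros HN HQ [Ha H0] Hneg.
  assert (Hx0 : 0 < 1 / (12 * N) <= 1 / 12).
  { split; [apply Rdiv_lt_0_compat; lra|].
    apply Rle_div_l; lra. }
  apply negative_definite4_of_kernel with (1 / (12 * N)); try apply HQ; [| lra |].
  - assert (Hhalf : forall x, 0 <= x <= 1 / 2 -> peano_kernel Q x <= 0).
    { intros x Hx; apply (scaled_kernel_sign Q N kappa); [lra | exact HQ | exact Hx |].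
      apply Hneg, Rmult_le_pos; lra. }
    intros x Hx; destruct (Rle_lt_dec x (1 / 2)); [apply Hhalf; lra|].
    rewrite <- (scaled_kernel_fold Q N kappa) by exact HQ; apply Hhalf; lra.
  - apply (scaled_kernel_sign Q N kappa); [lra | exact HQ | lra |].
    replace (N * (1 / (12 * N))) with (1 / 12) by (field; lra).
    rewrite H0 by lra; lra.
Qed.

Lemma exact_on_cubics_Q_hat (c : R) (Q1 Q2 : functional) :
  exact_on_cubics Q1 -> exact_on_cubics Q2 -> exact_on_cubics (Q_hat c Q1 Q2).
Proof. intros H1 H2 c0 c1 c2 c3; unfold Q_hat; rewrite H1, H2; ring. Qed.

Lemma scaled_kernel_Q_hat (c N : R) (Q' Q'' : functional) (kappa' kappa'' : R -> R) :
  has_scaled_kernel Q' (2 * N) kappa' -> has_scaled_kernel Q'' N kappa'' ->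
  has_scaled_kernel (Q_hat c Q' Q'') N
    (fun s => hat_kernel c kappa' kappa'' s / 16).
Proof.
  intros [A1 A2 A3 A4] [B1 B2 B3 B4]; split.
  - apply nodal_Q_hat; assumption.
  - apply exact_on_cubics_Q_hat; assumption.
  - intros f; unfold Q_hat; rewrite (A3 f), (B3 f); reflexivity.
  - intros x Hx; unfold hat_kernel; rewrite <- (B4 x Hx).
    replace (2 * (N * x)) with (2 * N * x) by ring; rewrite <- (A4 x Hx).
    unfold peano_kernel, Q_hat; field.
Qed.

Lemma smallest_positive_of_scaled
    (Q' Q'' : functional) (N c a' a'' : R) (kappa' kappa'' : R -> R) :
  1 <= N -> 0 < c ->
  has_scaled_kernel Q' (2 * N) kappa' -> has_scaled_kernel Q'' N kappa'' ->
  end_weight kappa' a' -> end_weight kappa'' a'' -> (c + 1) * a' <= 2 * c * a'' ->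
  (forall s, 0 <= s -> 0 <= hat_kernel c kappa' kappa'' s) ->
  (forall c', 0 < c' ->
     (forall s, 0 < s <= N / 2 -> 0 <= hat_kernel c' kappa' kappa'' s) -> c <= c') ->
  smallest_positive (fun c' => positive_definite4 (Q_hat c' Q' Q'')) c.
Proof.
  intros HN Hc HQ1 HQ2 [Ha1 H1] [Ha2 H2] Ha Hpos Hmin.
  pose proof (fun c => scaled_kernel_Q_hat c N _ _ _ _ HQ1 HQ2) as HQ.
  split; [exact Hc | split].
  - specialize (HQ c).
    assert (Hx0 : 0 < 1 / (24 * N) <= 1 / 24).
    { split; [apply Rdiv_lt_0_compat; lra|].
      apply Rle_div_l; lra. }
    apply positive_definite4_of_kernel with (1 / (24 * N)); try apply HQ; [| lra |].
    + assert (Hhalf : forall x, 0 <= x <= 1 / 2 -> 0 <= peano_kernel (Q_hat c Q' Q'') x).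
      { intros x Hx; eapply scaled_kernel_sign; [| exact HQ | exact Hx |]; [lra|].
        apply Rdiv_le_0_compat; [|lra]; apply Hpos, Rmult_le_pos; lra. }
      intros x Hx; destruct (Rle_lt_dec x (1 / 2)); [apply Hhalf; lra|].
      rewrite <- (scaled_kernel_fold _ _ _ _ HQ); apply Hhalf; lra.
    + eapply scaled_kernel_sign; [| exact HQ | lra |]; [lra|].
      replace (N * (1 / (24 * N))) with (1 / 24) by (field; lra).
      unfold hat_kernel; rewrite H1, H2 by lra; lra.
  - intros c' Hc' Hdef; apply Hmin; [exact Hc'|]; intros s Hs; specialize (HQ c').
    pose proof (kernel_nonneg_of_positive_definite4 _ (s / N)
                  (hsk_nodal _ _ _ HQ) (hsk_exact _ _ _ HQ) Hdef) as HK.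
    assert (Hx : 0 < s / N <= 1 / 2).
    { split; [apply Rdiv_lt_0_compat; lra | apply Rle_div_l; lra]. }
    destruct (scaled_kernel_sign _ N _ (s / N) ltac:(lra) HQ ltac:(lra))
      as [_ [_ [_ [_ H]]]].
    specialize (H (HK ltac:(lra))); simpl in H.
    replace (N * (s / N)) with s in H by (field; lra); lra.
Qed.

(** The term of order [s ^ 3] of [hat_kernel] at [0] must not be negative. *)
Lemma hat_kernel_end_weight (N c a' a'' : R) (kappa' kappa'' : R -> R) :
  1 <= N -> end_weight kappa' a' -> end_weight kappa'' a'' ->
  (forall s, 0 < s <= N / 2 -> 0 <= hat_kernel c kappa' kappa'' s) ->
  (c + 1) * a' <= 2 * c * a''.
Proof.
  intros HN [_ H1] [_ H2] H.
  destruct (Rle_lt_dec ((c + 1) * a') (2 * c * a'')) as [|Hd]; [assumption | exfalso].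
  pose (d := (c + 1) * a' - 2 * c * a''); pose (s := Rmin (1 / 24) d).
  assert (Hs : 0 < s /\ s <= 1 / 24 /\ s <= d).
  { repeat split; [apply Rmin_pos; unfold d; lra | apply Rmin_l | apply Rmin_r]. }
  specialize (H s ltac:(lra)); unfold hat_kernel in H.
  rewrite H1, H2 in H by lra.
  assert (E : (c + 1) * ((2 * s) ^ 4 - 4 * a' * (2 * s) ^ 3)
              - 16 * c * (s ^ 4 - 4 * a'' * s ^ 3)
              = 16 * (s ^ 3 * (s - 2 * d))) by (unfold d; ring).
  rewrite E in H.
  assert (0 < s ^ 3 * (2 * d - s)) by (apply Rmult_lt_0_compat; [apply pow_lt |]; lra).
  lra.
Qed.

(** At [s = 1 - u] the expression is [u ^ 2 * (6 * c - 2 + 16 * u ^ 2)]; the point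
    [s = 1] lies in the left half because [2 <= N]. *)
Lemma hat_kernel_interior_zero (N c : R) (kappa' kappa'' : R -> R) :
  2 <= N ->
  (forall s, 1 <= s -> kappa' s = periodic (s + 1 / 2) - 1 / 16) ->
  (forall s, 1 / 2 <= s -> kappa'' s = periodic (s + 1 / 2) - 1 / 16) ->
  (forall s, 0 < s <= N / 2 -> 0 <= hat_kernel c kappa' kappa'' s) ->
  1 / 3 <= c.
Proof.
  intros HN H1 H2 H.
  destruct (Rle_lt_dec (1 / 3) c) as [|Hd]; [assumption | exfalso].
  pose (u := Rmin (1 / 8) ((1 - 3 * c) / 2)).
  assert (Hu : 0 < u /\ u <= 1 / 8 /\ u <= (1 - 3 * c) / 2).
  { repeat split; [apply Rmin_pos; lra | apply Rmin_l | apply Rmin_r]. }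
  specialize (H (1 - u) ltac:(lra)); unfold hat_kernel in H.
  rewrite H1, H2 in H by lra.
  rewrite (periodic_midpoint_cell 2), (periodic_midpoint_cell 1) in H by lra.
  replace ((c + 1) * - ((2 * (1 - u) - 2) ^ 2 * (1 / 2 - (2 * (1 - u) - 2) ^ 2))
           - 16 * c * - ((1 - u - 1) ^ 2 * (1 / 2 - (1 - u - 1) ^ 2)))
    with (- (u ^ 2 * (2 - 6 * c - 16 * u ^ 2))) in H by field.
  assert (0 < u ^ 2 * (2 - 6 * c - 16 * u ^ 2)).
  { apply Rmult_lt_0_compat; [apply pow_lt; lra | nra]. }
  lra.
Qed.

Lemma end_weight_3_1_1 : end_weight kappa_3_1_1 (403 / 1152).
Proof. split; [lra | exact kappa_3_1_1_near_0]. Qed.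

Lemma end_weight_3_1_3 : end_weight kappa_3_1_3 (43 / 192).
Proof. split; [lra | exact kappa_3_1_3_near_0]. Qed.

Lemma end_weight_3_2_1 : end_weight kappa_3_2_1 (13 / 72).
Proof. split; [lra | exact kappa_3_2_1_near_0]. Qed.

Lemma end_weight_3_2_2 : end_weight kappa_3_2_2 (7 / 24).
Proof. split; [lra | exact kappa_3_2_2_near_0]. Qed.

Lemma end_weight_3_2_3 : end_weight kappa_3_2_3 (11 / 12).
Proof. split; [lra | exact kappa_3_2_3_near_0]. Qed.

Create HintDb quadrature.
#[export] Hint Resolve scaled_kernel_3_1_1 scaled_kernel_3_1_3 scaled_kernel_3_2_1
  scaled_kernel_3_2_2 scaled_kernel_3_2_3 end_weight_3_1_1 end_weight_3_1_3
  end_weight_3_2_1 end_weight_3_2_2 end_weight_3_2_3 kappa_3_1_1_nonpos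
  kappa_3_1_3_nonpos kappa_3_2_1_nonpos kappa_3_2_2_nonpos kappa_3_2_3_nonpos
  hat_kernel_3_2_1_3_1_1 hat_kernel_3_2_1_3_1_3 hat_kernel_3_2_1_3_2_1
  hat_kernel_3_2_1_3_2_2 hat_kernel_3_2_1_3_2_3 hat_kernel_3_2_2_3_1_1
  hat_kernel_3_2_2_3_1_3 hat_kernel_3_2_2_3_2_2 hat_kernel_3_2_2_3_2_3
  hat_kernel_3_2_3_3_2_3 : quadrature.

(** The common conclusion for a pair of families. *)
Lemma definiteness_of_scaled_kernels
    (F' F'' : formula_sequence) (n : nat) (c a' a'' : R) (kappa' kappa'' : R -> R) :
  (1 <= n)%nat -> 0 < c ->
  has_scaled_kernel (formula F' (2 * n)) (INR (2 * n)) kappa' ->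
  has_scaled_kernel (formula F'' n) (INR n) kappa'' ->
  end_weight kappa' a' -> end_weight kappa'' a'' -> (c + 1) * a' <= 2 * c * a'' ->
  (forall s, 0 <= s -> kappa' s <= 0) -> (forall s, 0 <= s -> kappa'' s <= 0) ->
  (forall s, 0 <= s -> 0 <= hat_kernel c kappa' kappa'' s) ->
  (forall c', 0 < c' ->
     (forall s, 0 < s <= INR n / 2 -> 0 <= hat_kernel c' kappa' kappa'' s) -> c <= c') ->
  negative_definite4 (formula F' (2 * n)) /\ negative_definite4 (formula F'' n) /\
  smallest_positive
    (fun c' => positive_definite4 (Q_hat c' (formula F' (2 * n)) (formula F'' n))) c.
Proof.
  intros Hn Hc H1 H2 Ha1 Ha2 Ha N1 N2 Hpos Hmin.
  apply le_INR in Hn; simpl in Hn.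
  rewrite mult_INR in H1; replace (INR 2) with 2 in H1 by (simpl; ring).
  repeat match goal with |- _ /\ _ => split end.
  - apply negative_definite4_of_scaled with (2 * INR n) a' kappa'; auto; lra.
  - apply negative_definite4_of_scaled with (INR n) a'' kappa''; auto; lra.
  - apply smallest_positive_of_scaled with (INR n) a' a'' kappa' kappa''; auto.
Qed.

Theorem theorem2 :
  forall (F' F'' : formula_sequence) (c : R),
    In (F', F'', c)
      [ (Q_3_2_1, Q_3_1_1, 104 / 299);
        (Q_3_2_1, Q_3_1_3, 52 / 77);
        (Q_3_2_1, Q_3_2_1, 1);
        (Q_3_2_1, Q_3_2_2, 13 / 29);
        (Q_3_2_1, Q_3_2_3, 1 / 3);
        (Q_3_2_2, Q_3_1_1, 168 / 235);
        (Q_3_2_2, Q_3_1_3, 28 / 15);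
        (Q_3_2_2, Q_3_2_2, 1);
        (Q_3_2_2, Q_3_2_3, 1 / 3);
        (Q_3_2_3, Q_3_2_3, 1) ] ->
    forall n : nat,
      (1 <= n)%nat -> (first_index F' <= 2 * n)%nat -> (first_index F'' <= n)%nat ->
      let Q' := formula F' (2 * n) in
      let Q'' := formula F'' n in
      negative_definite4 Q' /\
      negative_definite4 Q'' /\
      smallest_positive (fun c' : R => positive_definite4 (Q_hat c' Q' Q'')) c.
Proof.
  intros F' F'' c Hin n Hn H1 H2 Q' Q''; unfold Q', Q''; clear Q' Q''.
  pose proof (le_INR _ _ Hn) as HN; simpl in HN.
  repeat (destruct Hin as [Hin | Hin]; [injection Hin as <- <- <- |]); [.. | destruct Hin];
    cbn [first_index Q_3_1_1 Q_3_1_3 Q_3_2_1 Q_3_2_2 Q_3_2_3] in H1, H2;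
    (eapply definiteness_of_scaled_kernels;
     [ exact Hn | lra | eauto with quadrature .. | ]);
    try lra.
  all: intros c' Hc' Hhat.
  all: try (eapply hat_kernel_end_weight in Hhat;
            [| exact HN | eauto with quadrature ..]; lra).
  (* The end point does not decide the two pairs with constant [1 / 3]. *)
  (* Here [3 <= 2 * n] gives [2 <= n]. *)
  all: apply (hat_kernel_interior_zero (INR n) c' _ _ (le_INR 2 n ltac:(lia))) in Hhat;
    [ exact Hhat | | intros; apply kappa_3_2_3_interior; lra ].
  - exact kappa_3_2_1_interior.
  - exact kappa_3_2_2_interior.
Qed.
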